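(* Around $H_2$, the space of examples with complexity $m=2$ is a two-dimensional real analytic manifold. Precisely, let $\mathcal{S}$ be the set of all $(r_1,r_2,r_3,\theta_2,\theta_3)\in(0,\infty)^3\times\mathbb{R}^2$ such that, for $c=e^{i\beta}$ with $e^{2i(\beta+\theta_2+\theta_3)}=-1$, the list $(c,\,r_1,\,r_2e^{i\theta_2},\,r_3e^{i\theta_3})$ is a solution of the period problem with complexity $2$. Then there exist an open neighborhood $U\subset(0,\infty)^2$ of $(1,1)$, an open neighborhood $W\subset(0,\infty)^3\times\mathbb{R}^2$ of the point $(1,1,1,\frac{\pi}{3},\frac{2\pi}{3})$ (which corresponds to $H_2$), and a real analytic map $\varphi\colon U\to(0,\infty)\times\mathbb{R}^2$ such that $$\mathcal{S}\cap W=\{(r_1,r_2,\varphi(r_1,r_2)) : (r_1,r_2)\in U\},$$ i.e. near that point the elements of $\mathcal{S}$ are exactly those with $(r_3,\theta_2,\theta_3)=\varphi(r_1,r_2)$.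
   Context: For $(c,a_1,a_2,a_3)\in\mathbb{S}^1\times(\mathbb{C}\setminus\{0\})^3$ put $P(z)=\prod_{j=1}^{3}(z-a_j)\left(z+\frac1{\overline{a_j}}\right)=\sum_{h=0}^{6}A_hz^h$. The list $(c,a_1,a_2,a_3)$ is a solution of the period problem with complexity $2$ if $$-\frac{\overline c}{c}=\prod_{j=1}^{3}\frac{a_j}{\overline{a_j}},\qquad \overline{cA_2}=-cA_4,\qquad \mathrm{Im}(cA_3)=0 .$$ Such a list defines a 1-sided branched minimal surface with Weierstrass data $g(z)=z$, $\omega=c\,z^{-5}P(z)\,dz$. Up to rotation about the vertical axis one may assume $a_1=r_1>0$, and one writes $a_2=r_2e^{i\theta_2}$, $a_3=r_3e^{i\theta_3}$; then the first condition is $e^{2i(\beta+\theta_2+\theta_3)}=-1$ for $c=e^{i\beta}$, which determines $c$ up to sign, and the remaining conditions do not depend on that sign. The surface $H_2$ has Weierstrass data $g(z)=z$, $\omega=i\,z^{-5}(z^6-1)\,dz$. *)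

(* Defs.v *)
From HB Require Import structures.
From mathcomp Require Import all_boot all_order all_algebra.
From mathcomp Require Import complex.
From mathcomp Require Import all_classical all_reals all_analysis.

Set Implicit Arguments.
Unset Strict Implicit.
Unset Printing Implicit Defensive.

Import Order.TTheory GRing.Theory Num.Theory.
Import numFieldNormedType.Exports.

Local Open Scope classical_set_scope.
Local Open Scope ring_scope.
Local Open Scope complex_scope.

(* e^(i t) *)
Definition expi (R : realType) (t : R) : R[i] := cos t +i* sin t.

Definition period_poly (R : realType) (a1 a2 a3 : R[i]) : {poly R[i]} :=
  \prod_(a <- [:: a1; a2; a3]) (('X - a%:P) * ('X + ((a^*)^-1)%:P)).

Definition period_solution (R : realType) (c a1 a2 a3 : R[i]) : Prop :=
  let A := period_poly a1 a2 a3 in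
  [/\ `|c| = 1, [/\ a1 != 0, a2 != 0 & a3 != 0],
      - (c^* / c) = \prod_(a <- [:: a1; a2; a3]) (a / a^*),
      (c * A`_2)^* = - (c * A`_4)
    & complex.Im (c * A`_3) = 0].

(* The density f of the one-form omega = f dz on C \ {0}; the other datum, the
   Gauss map g(z) = z, is the same for all the surfaces considered. *)
Definition omega_density (R : realType) (c a1 a2 a3 z : R[i]) : R[i] :=
  c * z ^- 5 * (period_poly a1 a2 a3).[z].

Definition H2_omega_density (R : realType) (z : R[i]) : R[i] :=
  'i * z ^- 5 * (z ^+ 6 - 1).

(* The condition determines e^(i beta) only up to sign; [period_solution] is
   invariant under c |-> -c, so "for some beta" and "for every beta" define the
   same set. *)
Definition solution_set (R : realType) : set (R * R * R * R * R) :=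
  [set x | let: (r1, r2, r3, t2, t3) := x in
     [/\ 0 < r1, 0 < r2, 0 < r3 &
       exists beta : R, expi (2 * (beta + t2 + t3)) = -1 /\
         period_solution (expi beta)
           r1%:C (r2%:C * expi t2) (r3%:C * expi t3)]].

(* Near each point of U, f is the sum of a double power series centred there.
   The series converges absolutely, so its sum does not depend on the order of
   summation; it is computed along square partial sums. *)
Definition real_analytic2 (R : realType) (U : set (R * R)) (f : R * R -> R) :
    Prop :=
  forall p, U p -> exists a : nat -> nat -> R,
    \forall x \near p,
      let term i j := a i j * (x.1 - p.1) ^+ i * (x.2 - p.2) ^+ j in
      summable [set: nat * nat] (fun k => (term k.1 k.2)%:E) /\
      (fun n : nat => \sum_(i < n) \sum_(j < n) term i j) @ \oo --> f x.

(* Main.v *)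
Require Import Defs.
From HB Require Import structures.
From mathcomp Require Import all_boot all_order all_algebra.
From mathcomp Require Import complex ring lra.
From mathcomp Require Import all_classical all_reals all_analysis.

Set Implicit Arguments.
Unset Strict Implicit.
Unset Printing Implicit Defensive.

Import Order.TTheory GRing.Theory Num.Theory.
Import numFieldNormedType.Exports.

Local Open Scope classical_set_scope.
Local Open Scope ring_scope.
Local Open Scope complex_scope.

(** Write a_j = r_j u_j with |u_j| = 1 and s_j = r_j - 1/r_j, so that
    P = prod_j (z^2 - s_j u_j z - u_j^2).  The first period condition forces
    conj (c A_2) = c A_4, and A_3 = u_1 u_2 u_3 K with K real, so the remaining
    conditions say A_4 = 0 and K = 0.  Near H_2, A_4 = 0 splits into two real
    equations (imaginary parts of A_4 / (u_2 u_3) and A_4 / u_2) whose linear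
    parts are t2 + t3 - pi and 2 t3 - t2 - pi, while K = s_1 - s_2 + s_3 to first
    order.  The system is thus a fixed point equation v = T(x, y, v) with T a
    1/2-contraction on a small ball.

    The same contraction estimate holds in every commutative ring containing the
    reals with a submultiplicative norm, once sin, cos and h/(1+h) are replaced by
    Taylor polynomials whose degree grows along the iteration.  In R it gives
    existence and uniqueness of the solution.  In the ring of polynomials in two
    variables with a weighted l^1 norm on coefficients, with the parameters x, y
    replaced by h + X, k + Y, it shows that the iterates converge coefficientwise
    to an absolutely convergent double power series centred at (h, k). *)

(** * Normed commutative rings *)

(* [N] is a submultiplicative norm on a commutative ring into which the reals
   embed; it is used for [R] itself and for polynomials in two variables. *)
Record ring_norm (R : realType) (A : comNzRingType) (iota : {rmorphism R -> A})
    (N : A -> R) : Prop := RingNorm {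
  rn_ge0 : forall a, 0 <= N a;
  rnD : forall a b, N (a + b) <= N a + N b;
  rnN : forall a, N (- a) = N a;
  rnM : forall a b, N (a * b) <= N a * N b;
  rn_iota : forall c, N (iota c) <= `|c| }.

Section RingNorm.
Variables (R : realType) (A : comNzRingType) (iota : {rmorphism R -> A}).
Variables (N : A -> R).
Hypothesis normN : ring_norm iota N.

Lemma rn0 : N 0 = 0.
Proof.
apply/eqP; rewrite eq_le (rn_ge0 normN) andbT.
by have := rn_iota normN 0; rewrite rmorph0 normr0.
Qed.

Lemma rn_sum (I : Type) (s : seq I) (P : pred I) (F : I -> A) :
  N (\sum_(i <- s | P i) F i) <= \sum_(i <- s | P i) N (F i).
Proof.
elim/big_rec2: _ => [|i y x _ le_xy]; first by rewrite rn0.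
by apply: le_trans (rnD normN _ _) _; rewrite lerD2l.
Qed.

(** [d] is the scale of distance between two arguments, [B] a common norm bound and [K] a Lipschitz
    constant. The bound is carried along because products need it to propagate [K]. *)
Definition bclose (d B K : R) (f f' : A) : Prop :=
  [/\ N f <= B, N f' <= B & N (f - f') <= K * d].

Variable d : R.
Hypothesis d_ge0 : 0 <= d.

Lemma close_iota c : bclose d `|c| 0 (iota c) (iota c).
Proof. by split; rewrite ?subrr ?rn0 ?mul0r //; exact: (rn_iota normN). Qed.

Lemma closeW B K B' K' f f' :
  bclose d B K f f' -> B <= B' -> K <= K' -> bclose d B' K' f f'.
Proof.
move=> [fB f'B fK] BB' KK'; split; [exact: le_trans BB'|exact: le_trans BB'|].
by apply: le_trans fK _; rewrite ler_wpM2r.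
Qed.

Lemma closeD B K B' K' f f' g g' : bclose d B K f f' -> bclose d B' K' g g' ->
  bclose d (B + B') (K + K') (f + g) (f' + g').
Proof.
move=> [fB f'B fK] [gB g'B gK]; split.
- by apply: le_trans (rnD normN _ _) _; rewrite lerD.
- by apply: le_trans (rnD normN _ _) _; rewrite lerD.
- rewrite opprD addrACA mulrDl; apply: le_trans (rnD normN _ _) _.
  by rewrite lerD.
Qed.

Lemma closeN B K f f' : bclose d B K f f' -> bclose d B K (- f) (- f').
Proof.
by move=> [fB f'B fK]; split; rewrite -?opprD (rnN normN).
Qed.

Lemma closeB B K B' K' f f' g g' : bclose d B K f f' -> bclose d B' K' g g' ->
  bclose d (B + B') (K + K') (f - g) (f' - g').
Proof. by move=> cf cg; apply: closeD => //; exact: closeN. Qed.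

Lemma closeM B K B' K' f f' g g' : bclose d B K f f' -> bclose d B' K' g g' ->
  bclose d (B * B') (K * B' + B * K') (f * g) (f' * g').
Proof.
move=> [fB f'B fK] [gB g'B gK].
have ge0 := rn_ge0 normN; split.
- by apply: le_trans (rnM normN _ _) _; exact: ler_pM.
- by apply: le_trans (rnM normN _ _) _; exact: ler_pM.
have -> : f * g - f' * g' = (f - f') * g + f' * (g - g') by ring.
rewrite [leRHS]mulrDl; apply: le_trans (rnD normN _ _) _; apply: lerD.
  apply: le_trans (rnM normN _ _) _; rewrite mulrAC; exact: ler_pM.
by apply: le_trans (rnM normN _ _) _; rewrite -mulrA; exact: ler_pM.
Qed.

Lemma closeZ c B K f f' : bclose d B K f f' ->
  bclose d (`|c| * B) (`|c| * K) (iota c * f) (iota c * f').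
Proof. by move=> /(closeM (close_iota c)); rewrite mul0r add0r. Qed.

(* the terms of degree 2 to n+1 of the power series with coefficients c *)
Definition ps_tail (c : nat -> R) (n : nat) (h : A) : A :=
  \sum_(k < n) iota (c k.+2) * h ^+ k.+2.

Lemma ps_tailS c n h :
  ps_tail c n.+1 h = ps_tail c n h + iota (c n.+2) * h ^+ n.+2.
Proof. exact: big_ord_recr. Qed.

Variables (mu : R) (c : nat -> R) (h h' : A).
Hypotheses (mu_ge0 : 0 <= mu) (mu_small : mu <= 4^-1).
Hypothesis c_le1 : forall k, `|c k| <= 1.
Hypothesis hh' : bclose d mu 1 h h'.

(** The constant (k+2) mu^(k+1) is replaced by a geometric one, easier to sum; the induction rests
    on 3 mu <= 1. *)
Lemma close_expr k :
  bclose d (mu ^+ 2 * 2^-1 ^+ k) (2 * mu * 2^-1 ^+ k) (h ^+ k.+2) (h' ^+ k.+2).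
Proof.
elim: k => [|k IHk].
  rewrite !expr0 !mulr1; have := closeM hh' hh'; rewrite -!expr2.
  by move=> /closeW; apply; lra.
rewrite [h ^+ _]exprS [h' ^+ _]exprS; apply: closeW (closeM hh' IHk) _ _.
  rewrite [_ ^+ k.+1]exprS.
  have t0 : 0 <= (2^-1 : R) ^+ k by apply: exprn_ge0; lra.
  set t := (_ ^+ k : R) in t0 *.
  have : 0 <= mu ^+ 2 * t * (2^-1 - mu).
    have mu2 : mu <= 2^-1 by have := mu_small; lra.
    by rewrite !mulr_ge0 ?sqr_ge0 ?subr_ge0.
  lra.
rewrite [_ ^+ k.+1]exprS.
have t0 : 0 <= (2^-1 : R) ^+ k by apply: exprn_ge0; lra.
set t := (_ ^+ k : R) in t0 *.
have mu3 : 3 * mu <= 1 by have := mu_small; have := mu_ge0; lra.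
have : 0 <= mu * t * (1 - 3 * mu) by rewrite !mulr_ge0 ?subr_ge0.
nra.
Qed.

Lemma close_ps_tail_same n :
  bclose d (2 * mu ^+ 2) (4 * mu) (ps_tail c n h) (ps_tail c n h').
Proof.
(* The factors 1 - 2^-n come from the partial geometric sums and make the claim inductive. *)
suff : bclose d (2 * mu ^+ 2 * (1 - 2^-1 ^+ n)) (4 * mu * (1 - 2^-1 ^+ n))
    (ps_tail c n h) (ps_tail c n h').
  have t0 : 0 <= (2^-1 : R) ^+ n by apply: exprn_ge0; lra.
  set t := (_ ^+ n : R) in t0 * => /closeW; apply.
    have := mulr_ge0 (sqr_ge0 mu) t0; nra.
  have := mulr_ge0 mu_ge0 t0; nra.
elim: n => [|n IHn].
  by rewrite expr0 subrr !mulr0 /ps_tail !big_ord0; split;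
    rewrite ?subr0 ?rn0 ?mul0r.
rewrite !ps_tailS; apply: closeW (closeD IHn (closeZ (c n.+2) (close_expr n))) _ _.
  have t0 : 0 <= (2^-1 : R) ^+ n by apply: exprn_ge0; lra.
  have := ler_wpM2r (mulr_ge0 (sqr_ge0 mu) t0) (c_le1 n.+2).
  rewrite [_ ^+ n.+1]exprS; lra.
have t0 : 0 <= (2^-1 : R) ^+ n by apply: exprn_ge0; lra.
have := ler_wpM2r (mulr_ge0 mu_ge0 t0) (c_le1 n.+2).
rewrite [_ ^+ n.+1]exprS; lra.
Qed.

(** The orders of truncation differ by one: the extra term has norm at most mu^(n+2) <= mu d, which
    raises the constant from 4 mu to 5 mu. *)
Lemma close_ps_tail n : mu ^+ n.+1 <= d ->
  bclose d (2 * mu ^+ 2) (5 * mu) (ps_tail c n.+1 h) (ps_tail c n h').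
Proof.
move=> mu_d; have [_ B' K] := close_ps_tail_same n.
have [B _ _] := close_ps_tail_same n.+1.
split=> //; rewrite ps_tailS addrAC; apply: le_trans (rnD normN _ _) _.
have -> : 5 * mu * d = 4 * mu * d + mu * d by ring.
apply: lerD => //; apply: le_trans (rnM normN _ _) _.
rewrite -[mu * d]mul1r; apply: ler_pM; try exact: (rn_ge0 normN).
  exact: le_trans (rn_iota normN _) (c_le1 _).
have [hmu _ _] := hh'.
have expr_le m : N (h ^+ m.+1) <= mu ^+ m.+1.
  elim: m => [|m IHm]; first by rewrite !expr1.
  rewrite [h ^+ _]exprS [mu ^+ _]exprS; apply: le_trans (rnM normN _ _) _.
  by apply: ler_pM => //; exact: (rn_ge0 normN).
apply: le_trans (expr_le _) _; rewrite exprS.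
exact: ler_wpM2l.
Qed.

End RingNorm.

Lemma ring_norm_real (R : realType) : 
  ring_norm (idfun : {rmorphism R -> R}) Num.norm.
Proof.
split=> *; [exact: normr_ge0|exact: ler_normD|exact: normrN| |by []].
by rewrite normrM.
Qed.

(** * Weighted coefficient norms on polynomials *)

Section PolyNorm.
Variables (R : realType) (A : comNzRingType) (iota : {rmorphism R -> A}).
Variables (N : A -> R).
Hypothesis normN : ring_norm iota N.

(** The weighted l^1 norm, as the value at [r] of the polynomial of coefficient norms; norm
    inequalities then reduce to coefficientwise ones. *)
Definition poly_norm (r : R) (p : {poly A}) : R := (map_poly N p).[r].

Lemma coef_map_norm (p : {poly A}) i : (map_poly N p)`_i = N p`_i.
Proof. by apply: coef_map_id0; exact: (rn0 normN). Qed.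

Lemma poly_normE r (p : {poly A}) n : (size p <= n)%N ->
  poly_norm r p = \sum_(i < n) N p`_i * r ^+ i.
Proof.
move=> sp; rewrite /poly_norm (@horner_coef_wide _ n).
  by under eq_bigr do rewrite coef_map_norm.
by apply: leq_trans sp; exact: size_poly.
Qed.

Lemma ler_horner (p q : {poly R}) r : 0 <= r ->
  (forall i, p`_i <= q`_i) -> p.[r] <= q.[r].
Proof.
move=> r0 pq; set n := maxn (size p) (size q).
rewrite !(@horner_coef_wide _ n) ?leq_maxl ?leq_maxr //.
by apply: ler_sum => i _; rewrite ler_wpM2r ?exprn_ge0.
Qed.

Lemma ring_norm_poly r : 0 <= r -> ring_norm (polyC \o iota) (poly_norm r).
Proof.
move=> r0; split=> [a|a b|a|a b|c].
- rewrite -(horner0 r); apply: ler_horner => // i.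
  by rewrite coef0 coef_map_norm (rn_ge0 normN).
- rewrite /poly_norm -hornerD; apply: ler_horner => // i.
  by rewrite coefD !coef_map_norm coefD (rnD normN).
- congr (_.[_]); apply/polyP => i.
  by rewrite !coef_map_norm coefN (rnN normN).
- rewrite /poly_norm -hornerM; apply: ler_horner => // i.
  rewrite coef_map_norm !coefM; apply: le_trans (rn_sum normN _ _ _) _.
  by apply: ler_sum => j _; rewrite !coef_map_norm (rnM normN).
- rewrite (@poly_normE _ _ 1) ?size_polyC ?leq_b1 // big_ord1 coefC /= mulr1.
  exact: (rn_iota normN).
Qed.

Lemma poly_normX r : N 1 <= 1 -> 0 <= r -> poly_norm r 'X <= r.
Proof.
move=> N1 r0; rewrite (@poly_normE _ _ 2) ?size_polyX //.
rewrite !big_ord_recl big_ord0 !coefX /= (rn0 normN) mul0r add0r addr0 expr1.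
by rewrite -[leRHS]mul1r ler_wpM2r.
Qed.

Lemma poly_normC r a : poly_norm r a%:P = N a.
Proof.
by rewrite (@poly_normE _ _ 1) ?size_polyC ?leq_b1 // big_ord1 coefC /= mulr1.
Qed.

Lemma poly_norm_sum_le r (p : {poly A}) n : 0 <= r ->
  \sum_(i < n) N p`_i * r ^+ i <= poly_norm r p.
Proof.
move=> r0; rewrite (@poly_normE _ _ (maxn n (size p))) ?leq_maxr //.
rewrite (big_ord_widen _ (fun i => N p`_i * r ^+ i) (leq_maxl n (size p))).
rewrite big_mkcond; apply: ler_sum => i _; case: ifP => // _.
by rewrite mulr_ge0 ?exprn_ge0 // (rn_ge0 normN).
Qed.

End PolyNorm.

(** * The period map and its contraction estimate *)

Section PeriodStep.
Variables (R : realType) (A : comNzRingType) (iota : {rmorphism R -> A}).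
Variables S C G : A -> A.

(* With S, C, G standing for sin, cos and h |-> h/(1+h), a fixed point (z,a,b)
   of the three maps below solves the period equations at
   r1 = 1+x, r2 = 1+y, r3 = 1+z, a = t2+t3-pi, b = 2t3-t2-pi;
   [dtheta2], [dtheta3], [dtheta32] are then t2-pi/3, t3-2pi/3, t3-t2-pi/3. *)
Definition dtheta2 (a b : A) := iota (2 / 3) * a - iota (1 / 3) * b.
Definition dtheta3 (a b : A) := iota (1 / 3) * a + iota (1 / 3) * b.
Definition dtheta32 (a b : A) := iota (2 / 3) * b - iota (1 / 3) * a.
(** The addition formula for sin(t + h): only the small increment [h] passes through [S] and [C]. *)
Definition sin_shift (t : R) (h : A) := iota (sin t) * C h + iota (cos t) * S h.
Definition cos_shift (t : R) (h : A) := iota (cos t) * C h - iota (sin t) * S h.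

(* r - 1/r at r = 1 + h *)
Definition rgap (h : A) := h + G h.

(** With the true functions this is z - K/2, regrouped through 2 cos(pi/3 + p) = cos p - 2 sin(pi/3)
    sin p so that at x = y = 0 the terms linear in the unknowns visibly cancel. *)
Definition step_z (x y z a b : A) : A := iota (1 / 2) *
  ((z - G z)
   + rgap z * ((1 - C (dtheta2 a b))
               + iota 2 * (iota (sin (pi / 3)) * S (dtheta2 a b)))
   + rgap x * rgap y * rgap z
   - iota 2 * (rgap x * cos_shift (pi / 3) (dtheta32 a b))
   - iota 2 * (rgap y * cos_shift (2 * pi / 3) (dtheta3 a b))).

Definition step_a (x y z a b : A) : A :=
  (a - S a) - rgap x * (rgap y * sin_shift (2 * pi / 3) (dtheta3 a b)
                        + rgap z * sin_shift (pi / 3) (dtheta2 a b)).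

Definition step_b (x y z a b : A) : A :=
  (b - S b) - rgap z * (rgap x * sin_shift (pi / 3) (dtheta32 a b)
                        + rgap y * sin_shift (2 * pi / 3) (dtheta3 a b)).

End PeriodStep.

(** * Taylor truncations of sin, cos and h/(1+h) *)

Section Truncation.
Variables (R : realType) (A : comNzRingType) (iota : {rmorphism R -> A}).

Definition sin_ser (k : nat) : R := (odd k)%:R * (-1) ^+ k.-1./2 / k`!%:R.
Definition cos_ser (k : nat) : R := (~~ odd k)%:R * (-1) ^+ k./2 / k`!%:R.
Definition geo_ser (k : nat) : R := (-1) ^+ k.+1.

(** The part of degree below 2 is kept apart, so that [h - tsin n h], [1 - tcos n h] and
    [h - tgeo n h] are minus a tail, hence of second order. *)
Definition tsin n (h : A) := h + ps_tail iota sin_ser n h.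
Definition tcos n (h : A) := 1 + ps_tail iota cos_ser n h.
Definition tgeo n (h : A) := h + ps_tail iota geo_ser n h.

Definition tstep_z n := step_z iota (tsin n) (tcos n) (tgeo n).
Definition tstep_a n := step_a iota (tsin n) (tcos n) (tgeo n).
Definition tstep_b n := step_b iota (tsin n) (tcos n) (tgeo n).

Lemma bool_sign_fact_le1 (b : bool) k m : `|b%:R * (-1) ^+ k / m`!%:R : R| <= 1.
Proof.
rewrite !normrM normrX normrN normr1 expr1n mulr1 normfV normr_nat.
rewrite normr_nat; have m1 : 1 <= m`!%:R :> R by rewrite ler1n fact_gt0.
rewrite ler_pdivrMr ?(lt_le_trans ltr01) // mul1r; apply: le_trans m1.
by rewrite lern1 leq_b1.
Qed.

Lemma sin_ser_le1 k : `|sin_ser k| <= 1.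
Proof. exact: bool_sign_fact_le1. Qed.

Lemma cos_ser_le1 k : `|cos_ser k| <= 1.
Proof. exact: bool_sign_fact_le1. Qed.

Lemma geo_ser_le1 k : `|geo_ser k| <= 1.
Proof. by rewrite normrX normrN normr1 expr1n. Qed.

End Truncation.

Section Contraction.
Variables (R : realType) (A : comNzRingType) (iota : {rmorphism R -> A}).
Variables (N : A -> R).
Hypothesis normN : ring_norm iota N.

(* radii of the balls of unknowns (z,a,b) and of parameters (x,y) *)
Definition brad : R := 1 / 256.
Definition prad : R := 1 / 256 / 256.

Variables (d : R) (n : nat).
Hypotheses (d_ge0 : 0 <= d) (rad_d : brad ^+ n.+1 <= d).

Lemma closeZ1 c B K f f' : 0 <= B -> 0 <= K -> `|c| <= 1 ->
  bclose N d B K f f' -> bclose N d B K (iota c * f) (iota c * f').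
Proof.
move=> B0 K0 c1 /(closeZ normN c) /(closeW d_ge0); apply.
  by rewrite -[leRHS]mul1r ler_wpM2r.
by rewrite -[leRHS]mul1r ler_wpM2r.
Qed.

Lemma close2 B K f f' :
  bclose N d B K f f' -> bclose N d (2 * B) (2 * K) (iota 2 * f) (iota 2 * f').
Proof. by move=> /(closeZ normN 2); rewrite ger0_norm. Qed.

(** The angle increments are combinations of [a] and [b] with coefficients of total absolute value
    at most 1, so they stay in the same ball with Lipschitz constant 1. *)
Lemma close_comb B u v h h' k k' : 0 <= B -> `|u| + `|v| <= 1 ->
  bclose N d B 1 h h' -> bclose N d B 1 k k' ->
  bclose N d B 1 (iota u * h - iota v * k) (iota u * h' - iota v * k').
Proof.
move=> B0 uv /(closeZ normN u) cu /(closeZ normN v) cv.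
apply: closeW (closeB normN cu cv) _ _ => //; last by rewrite !mulr1.
by rewrite -mulrDl -[leRHS]mul1r ler_wpM2r.
Qed.

Section Angle.
Variables h h' : A.
Hypothesis hh' : bclose N d brad 1 h h'.

Lemma close_rad_tail c : (forall k, `|c k| <= 1) ->
  bclose N d (2 * brad ^+ 2) (5 * brad) (ps_tail iota c n.+1 h) (ps_tail iota c n h').
Proof.
by move=> c1; apply: (close_ps_tail normN d_ge0) => //; rewrite /brad; lra.
Qed.

Lemma close_tsin : bclose N d (1 / 100) 2 (tsin iota n.+1 h) (tsin iota n h').
Proof.
have := closeD normN hh' (close_rad_tail (@sin_ser_le1 R)).
by move=> /(closeW d_ge0); apply; rewrite /brad; lra.
Qed.

Lemma close_subr_tsin :
  bclose N d (2 * brad ^+ 2) (5 * brad) (h - tsin iota n.+1 h) (h' - tsin iota n h').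
Proof.
rewrite /tsin !opprD !addrA !subrr !add0r.
exact: closeN normN _ _ _ _ _ (close_rad_tail (@sin_ser_le1 R)).
Qed.

Lemma close_subr_tgeo :
  bclose N d (2 * brad ^+ 2) (5 * brad) (h - tgeo iota n.+1 h) (h' - tgeo iota n h').
Proof.
rewrite /tgeo !opprD !addrA !subrr !add0r.
exact: closeN normN _ _ _ _ _ (close_rad_tail (@geo_ser_le1 R)).
Qed.

Lemma close_1subr_tcos :
  bclose N d (2 * brad ^+ 2) (5 * brad) (1 - tcos iota n.+1 h) (1 - tcos iota n h').
Proof.
rewrite /tcos !opprD !addrA !subrr !add0r.
exact: closeN normN _ _ _ _ _ (close_rad_tail (@cos_ser_le1 R)).
Qed.

Lemma close_tcos : bclose N d 2 1 (tcos iota n.+1 h) (tcos iota n h').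
Proof.
have := close_iota normN d 1; rewrite rmorph1 normr1.
move=> /(closeD normN) /(_ (close_rad_tail (@cos_ser_le1 R))).
by move=> /(closeW d_ge0); apply; rewrite /brad; lra.
Qed.

Lemma close_rgap : bclose N d (3 * brad) 3
  (rgap (tgeo iota n.+1) h) (rgap (tgeo iota n) h').
Proof.
have := closeD normN hh' (closeD normN hh' (close_rad_tail (@geo_ser_le1 R))).
by move=> /(closeW d_ge0); apply; rewrite /brad; lra.
Qed.

Lemma close_sin_shift t : bclose N d 3 3
  (sin_shift iota (tsin iota n.+1) (tcos iota n.+1) t h)
  (sin_shift iota (tsin iota n) (tcos iota n) t h').
Proof.
have cc := closeZ1 _ _ _ close_tcos; have cs := closeZ1 _ _ _ close_tsin.
apply: closeW (closeD normN (cc (sin t) _ _ _) (cs (cos t) _ _ _)) _ _ => //;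
  rewrite ?sin_max ?cos_max //; lra.
Qed.

Lemma close_cos_shift t : bclose N d 3 3
  (cos_shift iota (tsin iota n.+1) (tcos iota n.+1) t h)
  (cos_shift iota (tsin iota n) (tcos iota n) t h').
Proof.
have cc := closeZ1 _ _ _ close_tcos; have cs := closeZ1 _ _ _ close_tsin.
apply: closeW (closeB normN (cc (cos t) _ _ _) (cs (sin t) _ _ _)) _ _ => //;
  rewrite ?sin_max ?cos_max //; lra.
Qed.

End Angle.

(** The parameter is the same on both sides; only the order of truncation changes, whence a constant
    proportional to [prad]. *)
Lemma close_rgap_param x : N x <= prad -> bclose N d (3 * prad) (5 * prad)
  (rgap (tgeo iota n.+1) x) (rgap (tgeo iota n) x).
Proof.
move=> xp; have xx K : 0 <= K -> bclose N d prad K x x.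
  by move=> K0; split; rewrite ?subrr ?(rn0 normN) ?mulr_ge0.
have pd : prad ^+ n.+1 <= d.
  by apply: le_trans rad_d; apply: lerXn2r; rewrite ?nnegrE /brad /prad; lra.
have p0 : 0 <= prad by rewrite /prad; lra.
have p1 : prad <= 4^-1 by rewrite /prad; lra.
have cg := close_ps_tail normN d_ge0 p0 p1 (@geo_ser_le1 R) (xx _ ler01) pd.
apply: closeW (closeD normN (xx 0 _) (closeD normN (xx 0 _) cg)) _ _ => //.
  by rewrite /prad; lra.
by rewrite /prad; lra.
Qed.

Variables x y z z' a a' b b' : A.
Hypotheses (x_small : N x <= prad) (y_small : N y <= prad).
Hypothesis zz' : bclose N d brad 1 z z'.
Hypothesis aa' : bclose N d brad 1 a a'.
Hypothesis bb' : bclose N d brad 1 b b'.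

Let rad0 : 0 <= brad. Proof. by rewrite /brad; lra. Qed.

Lemma close_dtheta2 : bclose N d brad 1 (dtheta2 iota a b) (dtheta2 iota a' b').
Proof. by apply: close_comb => //; rewrite !ger0_norm; lra. Qed.

Lemma close_dtheta32 : bclose N d brad 1 (dtheta32 iota a b) (dtheta32 iota a' b').
Proof. by apply: close_comb => //; rewrite !ger0_norm; lra. Qed.

Lemma close_dtheta3 : bclose N d brad 1 (dtheta3 iota a b) (dtheta3 iota a' b').
Proof.
have e u v : dtheta3 iota u v = iota (1 / 3) * u - iota (- (1 / 3)) * v.
  by rewrite rmorphN mulNr opprK.
rewrite !e.
by apply: close_comb => //; rewrite normrN !ger0_norm; lra.
Qed.

(** To first order the map takes the value y - x, which fits into [brad / 2] because [prad] is much
    smaller than [brad]. The Lipschitz constant is small since each unknown occurs with a small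
    factor. *)
Lemma close_tstep_z : bclose N d (brad / 2) (1 / 2)
  (tstep_z iota n.+1 x y z a b) (tstep_z iota n x y z' a' b').
Proof.
have sx := close_rgap_param x_small; have sy := close_rgap_param y_small.
have sz := close_rgap zz'.
have cp := close_1subr_tcos close_dtheta2.
have sp := close2 (closeZ1 _ _ _ (close_tsin close_dtheta2)).
have c32 := close2 (closeM normN sx (close_cos_shift close_dtheta32 (pi / 3))).
have c3 := close2 (closeM normN sy (close_cos_shift close_dtheta3 (2 * pi / 3))).
have T1 := closeM normN sz (closeD normN cp (sp (sin (pi / 3)) _ _ _)).
have T2 := closeM normN (closeM normN sx sy) sz.
have h2 : `|1 / 2 : R| <= 1 by rewrite ger0_norm; lra.
have T := closeB normN (closeB normN (closeD normN (closeD normN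
  (close_subr_tgeo zz') (T1 _ _ _)) T2) c32) c3.
apply: closeW (closeZ normN (1 / 2) (T _ _ _)) _ _ => //;
  rewrite ?sin_max // ?ger0_norm /brad /prad; lra.
Qed.

Lemma close_tstep_a : bclose N d (brad / 2) (1 / 2)
  (tstep_a iota n.+1 x y z a b) (tstep_a iota n x y z' a' b').
Proof.
have sx := close_rgap_param x_small; have sy := close_rgap_param y_small.
have sz := close_rgap zz'.
have T := closeB normN (close_subr_tsin aa') (closeM normN sx (closeD normN
  (closeM normN sy (close_sin_shift close_dtheta3 (2 * pi / 3)))
  (closeM normN sz (close_sin_shift close_dtheta2 (pi / 3))))).
by apply: closeW T _ _ => //; rewrite /brad /prad; lra.
Qed.

Lemma close_tstep_b : bclose N d (brad / 2) (1 / 2)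
  (tstep_b iota n.+1 x y z a b) (tstep_b iota n x y z' a' b').
Proof.
have sx := close_rgap_param x_small; have sy := close_rgap_param y_small.
have sz := close_rgap zz'.
have T := closeB normN (close_subr_tsin bb') (closeM normN sz (closeD normN
  (closeM normN sx (close_sin_shift close_dtheta32 (pi / 3)))
  (closeM normN sy (close_sin_shift close_dtheta3 (2 * pi / 3))))).
by apply: closeW T _ _ => //; rewrite /brad /prad; lra.
Qed.

End Contraction.

(** * Iteration of the truncated maps *)

Section Iteration.
Variables (R : realType) (A : comNzRingType) (iota : {rmorphism R -> A}).

(** Step [m] applies the maps truncated at order [m], so each iterate is a polynomial expression in
    [x] and [y] and makes sense in every ring considered. *)
Fixpoint iterate (x y : A) (n : nat) : A * A * A :=
  if n is m.+1 then
    let: (z, a, b) := iterate x y m in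
    (tstep_z iota m x y z a b, tstep_a iota m x y z a b, tstep_b iota m x y z a b)
  else (0, 0, 0).

Variables (N : A -> R).
Hypothesis normN : ring_norm iota N.
Variables x y : A.
Hypotheses (x_small : N x <= prad R) (y_small : N y <= prad R).

Lemma half_expr_ge0 n : 0 <= 2^-1 ^+ n :> R.
Proof. by apply: exprn_ge0; lra. Qed.

(** Each step halves the distance, and brad^(n+1) stays below the scale 2^-n, as the contraction
    estimate requires. *)
Lemma iterate_close n : let u := iterate x y n.+1 in let v := iterate x y n in
  [/\ bclose N (2^-1 ^+ n) (brad R / 2) 1 u.1.1 v.1.1,
      bclose N (2^-1 ^+ n) (brad R / 2) 1 u.1.2 v.1.2
    & bclose N (2^-1 ^+ n) (brad R / 2) 1 u.2 v.2].
Proof.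
have w0 (d : R) K B B' f f' :
    0 <= d -> B <= B' -> bclose N d B K f f' -> bclose N d B' K f f'.
  by move=> d0 BB' /closeW; apply.
have r0 : 0 <= brad R by rewrite /brad; lra.
have r2 : brad R / 2 <= brad R by rewrite /brad; lra.
elim: n => [|n IHn] /=.
  rewrite expr0.
  have r1 : brad R ^+ 1 <= 1 by rewrite expr1 /brad; lra.
  have c0 : bclose N 1 (brad R) 1 0 0.
    by split; rewrite ?subrr (rn0 normN) ?mul1r.
  (* Here [g] is the first iterate; its bound [brad / 2] already gives distance at most 1 from the
     starting point 0. *)
  have e0 f g : bclose N 1 (brad R / 2) (1 / 2) f g -> bclose N 1 (brad R / 2) 1 g 0.
    move=> [_ gB _]; split=> //; rewrite ?subr0 ?(rn0 normN) /brad; first lra.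
    by apply: le_trans gB _; rewrite /brad; lra.
  split.
  - exact: e0 (close_tstep_z normN ler01 r1 x_small y_small c0 c0 c0).
  - exact: e0 (close_tstep_a normN ler01 r1 x_small y_small c0 c0 c0).
  - exact: e0 (close_tstep_b normN ler01 r1 x_small y_small c0 c0 c0).
move: IHn; rewrite [iterate x y n.+1]/=; case: (iterate x y n) => [[z a] b] /=.
have h0 := @half_expr_ge0 n.
have hr : brad R ^+ n.+1 <= 2^-1 ^+ n.
  apply: (@le_trans _ _ (brad R ^+ n)).
    by rewrite exprS -[leRHS]mul1r ler_wpM2r ?exprn_ge0 // /brad; lra.
  by apply: lerXn2r; rewrite ?nnegrE /brad; lra.
move=> [/(w0 _ _ _ _ _ _ h0 r2) cz /(w0 _ _ _ _ _ _ h0 r2) ca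
  /(w0 _ _ _ _ _ _ h0 r2) cb].
have half f g : bclose N (2^-1 ^+ n) (brad R / 2) (1 / 2) f g ->
    bclose N (2^-1 ^+ n.+1) (brad R / 2) 1 f g.
  by move=> [fB gB fg]; split=> //; move: fg; rewrite mul1r exprS; lra.
split; apply: half.
- exact: (close_tstep_z normN h0 hr x_small y_small cz ca cb).
- exact: (close_tstep_a normN h0 hr x_small y_small cz ca cb).
- exact: (close_tstep_b normN h0 hr x_small y_small cz ca cb).
Qed.

End Iteration.

Section Morphism.
Variables (R : realType) (A A' : comNzRingType).
Variables (iota : {rmorphism R -> A}) (iota' : {rmorphism R -> A'}).
Variables (f : {rmorphism A -> A'}).
Hypothesis f_iota : forall c, f (iota c) = iota' c.

Lemma rmorph_ps_tail c n h : f (ps_tail iota c n h) = ps_tail iota' c n (f h).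
Proof.
rewrite rmorph_sum; apply: eq_bigr => k _.
by rewrite rmorphM f_iota rmorphXn.
Qed.

(** Evaluation of polynomials at a point will thereby carry polynomial iterates to real ones. *)
Lemma rmorph_iterate x y n : let u := iterate iota x y n in
  iterate iota' (f x) (f y) n = (f u.1.1, f u.1.2, f u.2).
Proof.
elim: n => [|n IHn] /=; first by rewrite rmorph0.
have fS h : f (tsin iota n h) = tsin iota' n (f h).
  by rewrite rmorphD rmorph_ps_tail.
have fC h : f (tcos iota n h) = tcos iota' n (f h).
  by rewrite rmorphD rmorph_ps_tail rmorph1.
have fG h : f (tgeo iota n h) = tgeo iota' n (f h).
  by rewrite rmorphD rmorph_ps_tail.
move: IHn => /= ->; case: (iterate iota x y n) => [[z a] b] /=.
rewrite /tstep_z /tstep_a /tstep_b /step_z /step_a /step_b.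
rewrite /rgap /sin_shift /cos_shift /dtheta2 /dtheta3 /dtheta32.
by rewrite !(f_iota, fS, fC, fG, rmorph1 f, rmorphB f, rmorphD f, rmorphM f).
Qed.

End Morphism.

(** * Sequences with geometrically decreasing increments *)

Section GeometricCauchy.
Variables (R : realType) (u : nat -> R) (M : R).
Hypothesis u_geo : forall n, `|u n.+1 - u n| <= M * 2^-1 ^+ n.

Lemma geo_dist n k : `|u (n + k)%N - u n| <= 2 * M * (2^-1 ^+ n - 2^-1 ^+ (n + k)).
Proof.
elim: k => [|k IHk]; first by rewrite addn0 !subrr normr0 mulr0.
rewrite addnS; have := u_geo (n + k); rewrite [_ ^+ (n + k).+1]exprS => hk.
have -> : u (n + k).+1 - u n = (u (n + k).+1 - u (n + k)%N) + (u (n + k)%N - u n) by ring.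
by apply: le_trans (ler_normD _ _) _; lra.
Qed.

Lemma geo_M_ge0 : 0 <= M.
Proof. by have := le_trans (normr_ge0 _) (u_geo 0); rewrite expr0 mulr1. Qed.

Lemma geo_is_cvg : cvgn u.
Proof.
(* Subtracting 2 M 2^-n makes the sequence nondecreasing, and it stays bounded above. *)
have -> : u = (fun n => (u n - 2 * M * 2^-1 ^+ n) + 2 * M * 2^-1 ^+ n).
  by apply/funext => n; rewrite subrK.
apply: is_cvgD.
  apply: nondecreasing_is_cvgn.
    apply/nondecreasing_seqP => n; rewrite exprS.
    by have := u_geo n; rewrite ler_norml => /andP[]; lra.
  exists (u 0%N + 2 * M) => _ [n _ <-].
  have := geo_dist 0 n; rewrite add0n expr0 ler_norml => /andP[_].
  have := mulr_ge0 geo_M_ge0 (half_expr_ge0 R n); lra.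
by apply/cvg_ex; exists 0; apply: cvg_geometric; rewrite ger0_norm; lra.
Qed.

End GeometricCauchy.

(** * From the truncations to the real functions *)

Section RealLimit.
Variable R : realType.
Implicit Types (x y z a b : R) (u : nat -> R).

Notation id := (idfun : {rmorphism R -> R}).

Definition rgeo (h : R) := h / (1 + h).
Definition rstep_z := step_z id (@sin R) (@cos R) rgeo.
Definition rstep_a := step_a id (@sin R) (@cos R) rgeo.
Definition rstep_b := step_b id (@sin R) (@cos R) rgeo.

Lemma series_ps_tail (c : nat -> R) h n :
  series (fun k => c k * h ^+ k) n.+2 = c 0%N + c 1%N * h + ps_tail id c n h.
Proof.
rewrite /series /= big_nat_recl // big_nat_recl // expr0 mulr1 expr1 addrA.
by rewrite big_mkord.
Qed.

Lemma cvg_series_shift2 (v : nat -> R) (l : R) :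
  series v @ \oo --> l -> (fun n => series v n.+2) @ \oo --> l.
Proof.
rewrite -[X in X -> _](cvg_shiftn 2) => vl; apply: cvg_trans vl.
by apply: near_eq_cvg; near=> n; rewrite /= addn2.
Unshelve. all: by end_near.
Qed.

Lemma cvg_tsin h : (fun n => tsin id n h) @ \oo --> sin h.
Proof.
have : series (fun k => sin_ser R k * h ^+ k) @ \oo --> sin h.
  have := is_cvg_series_sin_coeff (x := h); rewrite sin_coeffE.
  by rewrite unlock sin_coeffE.
have s0 : sin_ser R 0 = 0 by rewrite /sin_ser !mul0r.
have s1 : sin_ser R 1 = 1 by rewrite /sin_ser expr0 (_ : 1`! = 1%N) // mul1r divr1.
move=> /cvg_series_shift2; apply: cvg_trans; apply: near_eq_cvg; near=> n.
by rewrite series_ps_tail s0 s1 add0r mul1r.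
Unshelve. all: by end_near.
Qed.

Lemma cvg_tcos h : (fun n => tcos id n h) @ \oo --> cos h.
Proof.
have : series (fun k => cos_ser R k * h ^+ k) @ \oo --> cos h.
  have := is_cvg_series_cos_coeff (x := h); rewrite cos_coeffE.
  by rewrite unlock cos_coeffE.
have s0 : cos_ser R 0 = 1 by rewrite /cos_ser expr0 fact0 mul1r divr1.
have s1 : cos_ser R 1 = 0 by rewrite /cos_ser !mul0r.
move=> /cvg_series_shift2; apply: cvg_trans; apply: near_eq_cvg; near=> n.
by rewrite series_ps_tail s0 s1 mul0r addr0.
Unshelve. all: by end_near.
Qed.

Lemma cvg_tgeo h : `|h| < 1 -> (fun n => tgeo id n h) @ \oo --> rgeo h.
Proof.
move=> h1; have : series (geometric h (- h)) @ \oo --> h / (1 - - h).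
  by apply: cvg_geometric_series; rewrite normrN.
rewrite opprK -(cvg_shiftS); apply: cvg_trans; apply: near_eq_cvg.
near=> n; rewrite /tgeo /series /= big_nat_recl // expr0 mulr1; congr (_ + _).
rewrite big_mkord; apply: eq_bigr => k _; rewrite /geo_ser /=.
by rewrite (exprNn h) !exprS; ring.
Unshelve. all: by end_near.
Qed.

(** Order and argument vary together; the tails are Lipschitz uniformly in the order, so replacing
    [u n] by [h] costs at most |u_n - h|. *)
Lemma cvg_ps_tail (c : nat -> R) u (h l : R) : (forall k, `|c k| <= 1) ->
  (forall n, `|u n| <= brad R) -> `|h| <= brad R -> u @ \oo --> h ->
  (fun n => ps_tail id c n h) @ \oo --> l ->
  (fun n => ps_tail id c n (u n)) @ \oo --> l.
Proof.
move=> c1 ub hb uh hl.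
have -> : (fun n => ps_tail id c n (u n)) =
    (fun n => (ps_tail id c n (u n) - ps_tail id c n h) + ps_tail id c n h).
  by apply/funext => n; rewrite subrK.
rewrite -[l]add0r; apply: cvgD => //; apply: norm_cvg0.
have uh0 : (fun n => `|u n - h|) @ \oo --> (0 : R).
  rewrite -(normr0 R); apply: cvg_norm; rewrite -(subrr h).
  by apply: cvgB => //; exact: cvg_cst.
apply: (squeeze_cvgr _ (cvg_cst 0) uh0); near=> n; rewrite normr_ge0 /=.
have b0 : 0 <= brad R by rewrite /brad; lra.
have b4 : brad R <= 4^-1 by rewrite /brad; lra.
have hc : bclose Num.norm `|u n - h| (brad R) 1 (u n) h by split; rewrite ?mul1r.
have [_ _ K] := close_ps_tail_same (ring_norm_real R) (normr_ge0 _) b0 b4 c1 hc n.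
apply: le_trans K _; rewrite -[leRHS]mul1r ler_wpM2r // /brad; lra.
Unshelve. all: by end_near.
Qed.

(** [e] is the part of degree below 2: the identity for sin and h/(1+h), the constant 1 for cos. *)
Lemma cvg_tail_of (c : nat -> R) (T : nat -> R -> R) (e : R -> R) u (h l : R) :
  (forall n k, T n k = e k + ps_tail id c n k) -> 
  (forall (v : nat -> R) (k : R), v @ \oo --> k -> (fun n => e (v n)) @ \oo --> e k) ->
  (forall k, `|c k| <= 1) ->
  (forall n, `|u n| <= brad R) -> `|h| <= brad R -> u @ \oo --> h ->
  (fun n => T n h) @ \oo --> l -> (fun n => T n (u n)) @ \oo --> l.
Proof.
move=> TE ce c1 ub hb uh Th.
have hT : (fun n => ps_tail id c n h) @ \oo --> l - e h.
  have hc : (fun n => T n h - e h) @ \oo --> l - e h.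
    by apply: cvgB Th _; exact: cvg_cst.
  apply: cvg_trans hc; apply: near_eq_cvg; near=> n.
  by rewrite /= TE [e h + _]addrC addrK.
have -> : l = e h + (l - e h) by rewrite addrC subrK.
apply: cvg_trans (cvgD (ce _ _ uh) (cvg_ps_tail c1 ub hb uh hT)).
by apply: near_eq_cvg; near=> n; rewrite TE.
Unshelve. all: by end_near.
Qed.

Section Step.
Variables (x y z a b : R) (zn an bn : nat -> R).
Hypotheses (xb : `|x| <= prad R) (yb : `|y| <= prad R).
Hypotheses (zb : `|z| <= brad R) (ab : `|a| <= brad R) (bb : `|b| <= brad R).
Hypotheses (znb : forall n, `|zn n| <= brad R) (anb : forall n, `|an n| <= brad R)
  (bnb : forall n, `|bn n| <= brad R).
Hypotheses (zl : zn @ \oo --> z) (al : an @ \oo --> a) (bl : bn @ \oo --> b).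

Let ctsin (u : nat -> R) (h : R) : (forall n, `|u n| <= brad R) -> `|h| <= brad R ->
  u @ \oo --> h -> (fun n => tsin id n (u n)) @ \oo --> sin h.
Proof.
move=> ub hb uh; have TE n k : tsin id n k = k + ps_tail id (sin_ser R) n k by [].
have ce (v : nat -> R) (k : R) : v @ \oo --> k -> (fun n => v n) @ \oo --> k.
  exact.
exact: (cvg_tail_of (T := fun n k => tsin id n k) (e := fun k => k)
  TE ce (@sin_ser_le1 R) ub hb uh (@cvg_tsin h)).
Qed.

Let ctcos (u : nat -> R) (h : R) : (forall n, `|u n| <= brad R) -> `|h| <= brad R ->
  u @ \oo --> h -> (fun n => tcos id n (u n)) @ \oo --> cos h.
Proof.
move=> ub hb uh; have TE n k : tcos id n k = 1 + ps_tail id (cos_ser R) n k by [].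
have ce (v : nat -> R) (k : R) : v @ \oo --> k -> (fun=> 1 : R) @ \oo --> (1 : R).
  by move=> _; exact: cvg_cst.
exact: (cvg_tail_of (T := fun n k => tcos id n k) (e := fun k => 1)
  TE ce (@cos_ser_le1 R) ub hb uh (@cvg_tcos h)).
Qed.

Let ctgeo (u : nat -> R) (h : R) : (forall n, `|u n| <= brad R) -> `|h| <= brad R ->
  u @ \oo --> h -> (fun n => tgeo id n (u n)) @ \oo --> rgeo h.
Proof.
move=> ub hb uh; have h1 : `|h| < 1 by move: hb; rewrite /brad; lra.
have TE n k : tgeo id n k = k + ps_tail id (geo_ser R) n k by [].
have ce (v : nat -> R) (k : R) : v @ \oo --> k -> (fun n => v n) @ \oo --> k.
  exact.
exact: (cvg_tail_of (T := fun n k => tgeo id n k) (e := fun k => k)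
  TE ce (@geo_ser_le1 R) ub hb uh (@cvg_tgeo h h1)).
Qed.

Let comb (u v p q : R) : `|u| + `|v| <= 1 -> `|p| <= brad R -> `|q| <= brad R ->
  `|u * p + v * q| <= brad R.
Proof.
move=> uv pb qb; apply: le_trans (ler_normD _ _) _; rewrite !normrM.
apply: (@le_trans _ _ ((`|u| + `|v|) * brad R)).
  by rewrite mulrDl; apply: lerD; exact: ler_wpM2l.
by rewrite -[leRHS]mul1r ler_wpM2r // /brad; lra.
Qed.

Let d2b (p q : R) : `|p| <= brad R -> `|q| <= brad R -> `|dtheta2 id p q| <= brad R.
Proof.
by move=> *; rewrite /dtheta2 -mulNr; apply: comb => //; rewrite ?normrN !ger0_norm; lra.
Qed.
Let d3b (p q : R) : `|p| <= brad R -> `|q| <= brad R -> `|dtheta3 id p q| <= brad R.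
Proof. by move=> *; apply: comb => //; rewrite ?normrN !ger0_norm; lra. Qed.
Let d32b (p q : R) : `|p| <= brad R -> `|q| <= brad R -> `|dtheta32 id p q| <= brad R.
Proof.
by move=> *; rewrite /dtheta32 -mulNr; apply: comb => //; rewrite ?normrN !ger0_norm; lra.
Qed.

Let d2l : (fun n => dtheta2 id (an n) (bn n)) @ \oo --> dtheta2 id a b.
Proof. by apply: cvgB; apply: cvgMr. Qed.
Let d3l : (fun n => dtheta3 id (an n) (bn n)) @ \oo --> dtheta3 id a b.
Proof. by apply: cvgD; apply: cvgMr. Qed.
Let d32l : (fun n => dtheta32 id (an n) (bn n)) @ \oo --> dtheta32 id a b.
Proof. by apply: cvgB; apply: cvgMr. Qed.

Let csin_shift t (u : nat -> R) (h : R) :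
  (forall n, `|u n| <= brad R) -> `|h| <= brad R ->
  u @ \oo --> h ->
  (fun n => sin_shift id (tsin id n) (tcos id n) t (u n)) @ \oo -->
  sin_shift id (@sin R) (@cos R) t h.
Proof. by move=> ub hb uh; apply: cvgD; apply: cvgMr; [apply: ctcos|apply: ctsin]. Qed.

Let ccos_shift t (u : nat -> R) (h : R) :
  (forall n, `|u n| <= brad R) -> `|h| <= brad R ->
  u @ \oo --> h ->
  (fun n => cos_shift id (tsin id n) (tcos id n) t (u n)) @ \oo -->
  cos_shift id (@sin R) (@cos R) t h.
Proof. by move=> ub hb uh; apply: cvgB; apply: cvgMr; [apply: ctcos|apply: ctsin]. Qed.

Let crgap (u : nat -> R) (h : R) : (forall n, `|u n| <= brad R) -> `|h| <= brad R ->
  u @ \oo --> h ->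
  (fun n => rgap (tgeo id n) (u n)) @ \oo --> rgap rgeo h.
Proof. by move=> ub hb uh; apply: cvgD => //; exact: ctgeo. Qed.

Let xb' : `|x| <= brad R. Proof. by have := xb; rewrite /prad /brad; lra. Qed.
Let yb' : `|y| <= brad R. Proof. by have := yb; rewrite /prad /brad; lra. Qed.
Let gx : (fun n => rgap (tgeo id n) x) @ \oo --> rgap rgeo x.
Proof. by apply: (crgap (u := fun=> x)) => //; exact: cvg_cst. Qed.
Let gy : (fun n => rgap (tgeo id n) y) @ \oo --> rgap rgeo y.
Proof. by apply: (crgap (u := fun=> y)) => //; exact: cvg_cst. Qed.

(** Varying arguments serve twice: along the iterates the limit is a fixed point, and along constant
    sequences the contraction passes to the untruncated map. *)
Lemma cvg_tstep_z :
  (fun n => tstep_z id n x y (zn n) (an n) (bn n)) @ \oo --> rstep_z x y z a b.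
Proof.
apply: cvgMr; apply: cvgB; last first.
  apply: cvgMr; apply: cvgM => //.
  by apply: ccos_shift => //; [move=> n; exact: d3b|exact: d3b].
apply: cvgB; last first.
  apply: cvgMr; apply: cvgM => //.
  by apply: ccos_shift => //; [move=> n; exact: d32b|exact: d32b].
apply: cvgD; last by apply: cvgM; [exact: cvgM|exact: crgap].
apply: cvgD; first by apply: cvgB => //; exact: ctgeo.
apply: cvgM; first exact: crgap.
apply: cvgD.
  apply: cvgB; first exact: cvg_cst.
  by apply: ctcos => //; [move=> n; exact: d2b|exact: d2b].
apply: cvgMr; apply: cvgMr.
by apply: ctsin => //; [move=> n; exact: d2b|exact: d2b].
Qed.

Lemma cvg_tstep_a :
  (fun n => tstep_a id n x y (zn n) (an n) (bn n)) @ \oo --> rstep_a x y z a b.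
Proof.
apply: cvgB; first by apply: cvgB => //; exact: ctsin.
apply: cvgM => //; apply: cvgD; apply: cvgM => //; last 1 first.
- by apply: csin_shift => //; [move=> n; exact: d2b|exact: d2b].
- by apply: csin_shift => //; [move=> n; exact: d3b|exact: d3b].
exact: crgap.
Qed.

Lemma cvg_tstep_b :
  (fun n => tstep_b id n x y (zn n) (an n) (bn n)) @ \oo --> rstep_b x y z a b.
Proof.
apply: cvgB; first by apply: cvgB => //; exact: ctsin.
apply: cvgM; first exact: crgap.
apply: cvgD; apply: cvgM => //.
- by apply: csin_shift => //; [move=> n; exact: d32b|exact: d32b].
- by apply: csin_shift => //; [move=> n; exact: d3b|exact: d3b].
Qed.

End Step.

End RealLimit.

(** * The real fixed point *)

Section FixedPoint.
Variable R : realType.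

Notation id := (idfun : {rmorphism R -> R}).

Definition zlim (x y : R) : R := limn (fun n => (iterate id x y n).1.1).
Definition alim (x y : R) : R := limn (fun n => (iterate id x y n).1.2).
Definition blim (x y : R) : R := limn (fun n => (iterate id x y n).2).

Section Param.
Variables x y : R.
Hypotheses (xb : `|x| <= prad R) (yb : `|y| <= prad R).

Let zn n := (iterate id x y n).1.1.
Let an n := (iterate id x y n).1.2.
Let bn n := (iterate id x y n).2.

Let step n := iterate_close (ring_norm_real R) xb yb n.

Let zn_geo n : `|zn n.+1 - zn n| <= 1 * 2^-1 ^+ n.
Proof. by have [[]] := step n. Qed.
Let an_geo n : `|an n.+1 - an n| <= 1 * 2^-1 ^+ n.
Proof. by have [_ []] := step n. Qed.
Let bn_geo n : `|bn n.+1 - bn n| <= 1 * 2^-1 ^+ n.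
Proof. by have [_ _ []] := step n. Qed.

Let zl : zn @ \oo --> zlim x y. Proof. exact: geo_is_cvg zn_geo. Qed.
Let al : an @ \oo --> alim x y. Proof. exact: geo_is_cvg an_geo. Qed.
Let bl : bn @ \oo --> blim x y. Proof. exact: geo_is_cvg bn_geo. Qed.

Lemma cvg_iterate : [/\ (fun n => (iterate id x y n).1.1) @ \oo --> zlim x y,
  (fun n => (iterate id x y n).1.2) @ \oo --> alim x y
  & (fun n => (iterate id x y n).2) @ \oo --> blim x y].
Proof. by split; [exact: zl|exact: al|exact: bl]. Qed.

Let znb n : `|zn n| <= brad R / 2. Proof. by have [[]] := step n. Qed.
Let anb n : `|an n| <= brad R / 2. Proof. by have [_ []] := step n. Qed.
Let bnb n : `|bn n| <= brad R / 2. Proof. by have [_ _ []] := step n. Qed.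

Let lim_bound (u : nat -> R) (l : R) : (forall n, `|u n| <= brad R / 2) ->
  u @ \oo --> l -> `|l| <= brad R / 2.
Proof.
by move=> ub /cvg_norm ul; apply: (cvgr_to_le ul); near=> n.
Unshelve. all: by end_near.
Qed.

(** Half the radius places the limit strictly inside the ball, as membership in an open box will
    require. *)
Lemma lim_iterate_bound : [/\ `|zlim x y| <= brad R / 2, `|alim x y| <= brad R / 2
  & `|blim x y| <= brad R / 2].
Proof. by split; [exact: lim_bound zl|exact: lim_bound al|exact: lim_bound bl]. Qed.

Let le_brad (r : R) : r <= brad R / 2 -> r <= brad R.
Proof. by rewrite /brad; lra. Qed.

Let iterateS n : iterate id x y n.+1 = (tstep_z id n x y (zn n) (an n) (bn n),
  tstep_a id n x y (zn n) (an n) (bn n), tstep_b id n x y (zn n) (an n) (bn n)).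
Proof. by rewrite /zn /an /bn /=; case: (iterate id x y n) => [[]]. Qed.

Let lim_step (u v : nat -> R) (l l' : R) : u @ \oo --> l -> v @ \oo --> l' ->
  (forall n, u n.+1 = v n) -> l = l'.
Proof.
rewrite -(cvg_shiftS u) => ul vl uv; have e : [sequence u n.+1]_n = v by apply/funext.
by rewrite e in ul; exact: cvg_unique ul vl.
Qed.

Lemma lim_iterate_fixed :
  [/\ zlim x y = rstep_z x y (zlim x y) (alim x y) (blim x y),
      alim x y = rstep_a x y (zlim x y) (alim x y) (blim x y)
    & blim x y = rstep_b x y (zlim x y) (alim x y) (blim x y)].
Proof.
have [/le_brad zb /le_brad ab /le_brad bb] := lim_iterate_bound.
have znb' n := le_brad (znb n); have anb' n := le_brad (anb n).
have bnb' n := le_brad (bnb n).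
split.
- apply: lim_step zl (cvg_tstep_z xb yb zb ab bb znb' anb' bnb' zl al bl) _ => n.
  by rewrite /zn iterateS.
- apply: lim_step al (cvg_tstep_a xb yb zb ab bb znb' anb' bnb' zl al bl) _ => n.
  by rewrite /an iterateS.
- apply: lim_step bl (cvg_tstep_b xb yb zb ab bb znb' anb' bnb' zl al bl) _ => n.
  by rewrite /bn iterateS.
Qed.

(** Let [d] be the largest coordinate distance. If d > 0, the truncated contraction applies once
    brad^(n+1) <= d, hence eventually, and in the limit gives d <= d/2. *)
Lemma fixed_unique (z a b z' a' b' : R) :
  `|z| <= brad R -> `|a| <= brad R -> `|b| <= brad R ->
  `|z'| <= brad R -> `|a'| <= brad R -> `|b'| <= brad R ->
  z = rstep_z x y z a b -> a = rstep_a x y z a b -> b = rstep_b x y z a b ->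
  z' = rstep_z x y z' a' b' -> a' = rstep_a x y z' a' b' ->
  b' = rstep_b x y z' a' b' -> [/\ z = z', a = a' & b = b'].
Proof.
move=> zb ab bb zb' ab' bb' ez ea eb ez' ea' eb'.
pose d := Num.max `|z - z'| (Num.max `|a - a'| `|b - b'|).
have dz : `|z - z'| <= d by rewrite /d le_max lexx.
have da : `|a - a'| <= d by rewrite /d !le_max lexx orbT.
have db : `|b - b'| <= d by rewrite /d !le_max lexx !orbT.
suff d0 : d <= 0.
  by split; apply/eqP; rewrite -subr_eq0 -normr_le0; apply: le_trans d0.
rewrite leNgt; apply/negP => d0.
have cz : bclose Num.norm d (brad R) 1 z z' by split; rewrite ?mul1r.
have ca : bclose Num.norm d (brad R) 1 a a' by split; rewrite ?mul1r.
have cb : bclose Num.norm d (brad R) 1 b b' by split; rewrite ?mul1r.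
have cst (k : R) : (fun n : nat => k) @ \oo --> k by exact: cvg_cst.
have rad0 : (fun n => brad R ^+ n.+1) @ \oo --> (0 : R).
  have h : geometric (brad R) (brad R) @ \oo --> (0 : R).
    by apply: cvg_geometric; rewrite ger0_norm /brad; lra.
  by apply: cvg_trans h; apply: near_eq_cvg; near=> n; rewrite /= exprS.
have nd : \forall n \near \oo, brad R ^+ n.+1 <= d := cvgr_le _ rad0 _ d0.
have half (u v : nat -> R) (l l' : R) : u @ \oo --> l -> v @ \oo --> l' ->
    (forall n, brad R ^+ n.+1 <= d ->
      bclose Num.norm d (brad R / 2) (1 / 2) (u n.+1) (v n)) -> `|l - l'| <= 1 / 2 * d.
  rewrite -(cvg_shiftS u) => ul vl uv.
  have uvl : (fun n => `|u n.+1 - v n|) @ \oo --> `|l - l'|.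
    by apply: cvg_norm; exact: cvgB ul vl.
  apply: (cvgr_to_le uvl).
  near=> n; have [|_ _] := uv n; first by near: n; exact: nd.
  exact.
have hz : `|z - z'| <= 1 / 2 * d.
  rewrite ez ez'; apply: half
    (cvg_tstep_z xb yb zb ab bb _ _ _ (cst z) (cst a) (cst b))
    (cvg_tstep_z xb yb zb' ab' bb' _ _ _ (cst z') (cst a') (cst b')) _ => // n nd'.
  exact: (close_tstep_z (ring_norm_real R) (ltW d0) nd' xb yb cz ca cb).
have ha : `|a - a'| <= 1 / 2 * d.
  rewrite ea ea'; apply: half
    (cvg_tstep_a xb yb zb ab bb _ _ _ (cst z) (cst a) (cst b))
    (cvg_tstep_a xb yb zb' ab' bb' _ _ _ (cst z') (cst a') (cst b')) _ => // n nd'.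
  exact: (close_tstep_a (ring_norm_real R) (ltW d0) nd' xb yb cz ca cb).
have hb : `|b - b'| <= 1 / 2 * d.
  rewrite eb eb'; apply: half
    (cvg_tstep_b xb yb zb ab bb _ _ _ (cst z) (cst a) (cst b))
    (cvg_tstep_b xb yb zb' ab' bb' _ _ _ (cst z') (cst a') (cst b')) _ => // n nd'.
  exact: (close_tstep_b (ring_norm_real R) (ltW d0) nd' xb yb cz ca cb).
have : d <= 1 / 2 * d by rewrite {1}/d !ge_max hz ha hb.
lra.
Unshelve. all: by end_near.
Qed.

End Param.
End FixedPoint.

Lemma cvg_ord_sum (R : realType) m (f : 'I_m -> nat -> R) (l : 'I_m -> R) :
  (forall i, f i @ \oo --> l i) ->
  (fun n => \sum_(i < m) f i n) @ \oo --> \sum_(i < m) l i.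
Proof.
move=> fl; elim: (index_enum 'I_m) => [|i s IHs].
  rewrite big_nil; under eq_fun do rewrite big_nil; exact: cvg_cst.
rewrite big_cons; under eq_fun do rewrite big_cons.
exact: cvgD (fl i) IHs.
Qed.

(** Leads from square partial sums to the arbitrary finite index sets of summability: up to order,
    [s] is a sublist of the enumeration of the square. *)
Lemma ler_sum_square (R : realType) (g : nat -> nat -> R) (s : seq (nat * nat)) m :
  (forall i j, 0 <= g i j) -> uniq s ->
  {in s, forall k, (k.1 < m)%N && (k.2 < m)%N} ->
  \sum_(k <- s) g k.1 k.2 <= \sum_(i < m) \sum_(j < m) g i j.
Proof.
move=> g0 us sm; pose sq := [seq (i, j) | i <- iota 0 m, j <- iota 0 m].
have perm_s : perm_eq s [seq k <- sq | k \in s].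
  apply: uniq_perm => //.
    rewrite filter_uniq // allpairs_uniq ?iota_uniq //.
    by move=> [? ?] [? ?] _ _.
  move=> k; rewrite mem_filter; case ks : (k \in s) => //=.
  have /andP[k1 k2] := sm k ks; apply/esym/allpairsP; exists k.
  by rewrite !mem_iota !add0n k1 k2 -surjective_pairing.
have -> : \sum_(i < m) \sum_(j < m) g i j = \sum_(k <- sq) g k.1 k.2.
  have io (F : nat -> R) : \sum_(i <- iota 0 m) F i = \sum_(i < m) F i.
    by rewrite -[X in iota _ X]subn0 -/(index_iota 0 m) big_mkord.
  by rewrite big_allpairs /= io; apply: eq_bigr => i _; rewrite io.
rewrite (perm_big _ perm_s) /= big_filter big_mkcond.
by apply: ler_sum => k _; case: ifP.
Qed.

(** * Double power series as limits of polynomials *)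

Section BivariateLimit.
Variable R : realType.

Notation poly2 := {poly {poly R}}.

Definition iota2 : {rmorphism R -> poly2} := polyC \o polyC \o (idfun : {rmorphism R -> R}).
Definition norm2 (r : R) : poly2 -> R := poly_norm (poly_norm Num.norm r) r.
(** The outer variable is the first coordinate and the inner one the second. *)
Definition eval2 (u v : R) : {rmorphism poly2 -> R} :=
  horner_eval v \o horner_eval u%:P.

Lemma ring_norm2 r : 0 <= r -> ring_norm iota2 (norm2 r).
Proof.
move=> r0; have := ring_norm_poly (ring_norm_poly (ring_norm_real R) r0) r0.
by case=> *; split.
Qed.

Lemma eval2_iota u v c : eval2 u v (iota2 c) = c.
Proof. by rewrite /eval2 /iota2 /= /horner_eval !hornerC. Qed.

Lemma eval2E u v (P : poly2) m : (size P <= m)%N -> (forall i, (size (P`_i)%R <= m)%N) ->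
  eval2 u v P = \sum_(i < m) \sum_(j < m) P`_i`_j * u ^+ i * v ^+ j.
Proof.
move=> sP sPi; rewrite /eval2 /= /horner_eval (horner_coef_wide _ sP).
rewrite horner_sum; apply: eq_bigr => i _.
rewrite hornerM -polyC_exp hornerC (horner_coef_wide _ (sPi i)) mulr_suml.
by apply: eq_bigr => j _; rewrite mulrAC.
Qed.

Lemma norm2_sum_le r (P : poly2) m : 0 <= r ->
  \sum_(i < m) \sum_(j < m) `|P`_i`_j| * r ^+ i * r ^+ j <= norm2 r P.
Proof.
move=> r0; have n1 := ring_norm_poly (ring_norm_real R) r0.
apply: le_trans (poly_norm_sum_le n1 P m r0); apply: ler_sum => i _.
under eq_bigr do rewrite mulrAC.
rewrite -mulr_suml; apply: ler_wpM2r; first exact: exprn_ge0.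
exact: (poly_norm_sum_le (ring_norm_real R) _ _ r0).
Qed.

Lemma norm2_eval u v r P : 0 <= r -> `|u| <= r -> `|v| <= r ->
  `|eval2 u v P| <= norm2 r P.
Proof.
move=> r0 ur vr; pose m := maxn (size P) (\max_(i < size P) size (P`_i)%R).
have sP : (size P <= m)%N by rewrite leq_maxl.
have sPi i : (size (P`_i)%R <= m)%N.
  case: (ltnP i (size P)) => iP; last by rewrite nth_default ?size_poly0.
  apply: leq_trans (leq_maxr _ _).
  exact: (@leq_bigmax _ (fun k : 'I_(size P) => size (P`_k)%R) (Ordinal iP)).
rewrite (eval2E _ _ sP sPi); apply: le_trans (norm2_sum_le P m r0).
apply: le_trans (ler_norm_sum _ _ _) _; apply: ler_sum => i _.
apply: le_trans (ler_norm_sum _ _ _) _; apply: ler_sum => j _.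
by rewrite !normrM !normrX !ler_pM ?mulr_ge0 ?exprn_ge0 // lerXn2r ?nnegrE.
Qed.

(** A Cauchy estimate, turning geometric increments in norm into geometric increments of each
    coefficient. *)
Lemma norm2_coef r (P : poly2) i j : 0 <= r -> `|P`_i`_j| * r ^+ (i + j) <= norm2 r P.
Proof.
move=> r0; pose m := (maxn i j).+1.
have im : (i < m)%N by rewrite ltnS leq_maxl.
have jm : (j < m)%N by rewrite ltnS leq_maxr.
apply: le_trans (norm2_sum_le P m r0).
rewrite (bigD1 (Ordinal im)) //= (bigD1 (Ordinal jm)) //= exprD mulrA -addrA.
rewrite lerDl addr_ge0 ?sumr_ge0 // => [k _|k _].
  by rewrite !mulr_ge0 ?exprn_ge0.
by apply: sumr_ge0 => l _; rewrite !mulr_ge0 ?exprn_ge0.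
Qed.

Section Limit.
Variables (r M : R) (P : nat -> poly2).
Hypothesis r_gt0 : 0 < r.
Hypothesis P_geo : forall n, norm2 r (P n.+1 - P n) <= M * 2^-1 ^+ n.

Let r_ge0 : 0 <= r. Proof. exact: ltW. Qed.

Definition lim_coef i j : R := limn (fun n => (P n)`_i`_j).

Lemma coef_geo i j n : `|(P n.+1)`_i`_j - (P n)`_i`_j| <= M / r ^+ (i + j) * 2^-1 ^+ n.
Proof.
have rij : 0 < r ^+ (i + j) by rewrite exprn_gt0.
rewrite mulrAC ler_pdivlMr //; apply: le_trans (P_geo n).
by apply: le_trans (norm2_coef _ i j r_ge0); rewrite !coefB.
Qed.

Lemma cvg_coef i j : (fun n => (P n)`_i`_j) @ \oo --> lim_coef i j.
Proof. exact: geo_is_cvg (coef_geo i j). Qed.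

Lemma norm2_geo n k : norm2 r (P (n + k)%N - P n) <= 2 * M * (2^-1 ^+ n - 2^-1 ^+ (n + k)).
Proof.
elim: k => [|k IHk].
  by rewrite addn0 !subrr mulr0 (rn0 (ring_norm2 r_ge0)).
rewrite addnS; have := P_geo (n + k); rewrite [_ ^+ (n + k).+1]exprS => hk.
have -> : P (n + k).+1 - P n = (P (n + k).+1 - P (n + k)%N) + (P (n + k)%N - P n) by ring.
by apply: le_trans (rnD (ring_norm2 r_ge0) _ _) _; lra.
Qed.

Lemma limit_M_ge0 : 0 <= M.
Proof.
by have := le_trans (rn_ge0 (ring_norm2 r_ge0) _) (P_geo 0); rewrite expr0 mulr1.
Qed.

(** On a fixed square, the sum for P_(n+k) - P_n is bounded by its norm; then k tends to
    infinity. *)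
Lemma lim_coef_tail n m :
  \sum_(i < m) \sum_(j < m) `|lim_coef i j - (P n)`_i`_j| * r ^+ i * r ^+ j
  <= 2 * M * 2^-1 ^+ n.
Proof.
have cv : (fun k => \sum_(i < m) \sum_(j < m)
      `|(P (n + k)%N)`_i`_j - (P n)`_i`_j| * r ^+ i * r ^+ j) @ \oo -->
    \sum_(i < m) \sum_(j < m) `|lim_coef i j - (P n)`_i`_j| * r ^+ i * r ^+ j.
  apply: cvg_ord_sum => i; apply: cvg_ord_sum => j.
  apply: cvgMl; apply: cvgMl; apply: cvg_norm; apply: cvgB; last exact: cvg_cst.
  have := @cvg_coef i j; rewrite -(cvg_shiftn n).
  by under [X in X @ _ --> _]eq_fun do rewrite addnC.
apply: (cvgr_to_le cv); near=> k.
under eq_bigr do under eq_bigr do rewrite -!coefB.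
apply: le_trans (norm2_sum_le _ m r_ge0) _; apply: le_trans (norm2_geo n k) _.
have := mulr_ge0 limit_M_ge0 (half_expr_ge0 R (n + k)); lra.
Unshelve. all: by end_near.
Qed.

Variables u v : R.
Hypotheses (ur : `|u| <= r) (vr : `|v| <= r).

Lemma lim_coef_sum m :
  \sum_(i < m) \sum_(j < m) `|lim_coef i j * u ^+ i * v ^+ j|
  <= 2 * M + norm2 r (P 0).
Proof.
have -> : 2 * M = 2 * M * 2^-1 ^+ 0 by rewrite expr0 mulr1.
apply: le_trans (lerD (lim_coef_tail 0 m) (norm2_sum_le (P 0) m r_ge0)).
rewrite -big_split; apply: ler_sum => i _ /=.
rewrite -big_split; apply: ler_sum => j _ /=.
rewrite -!mulrDl !normrM !normrX.
have h : `|lim_coef i j| <= `|lim_coef i j - (P 0)`_i`_j| + `|(P 0)`_i`_j|.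
  by rewrite -{1}(subrK ((P 0)`_i`_j) (lim_coef i j)) ler_normD.
by rewrite !ler_pM ?mulr_ge0 ?exprn_ge0 // lerXn2r ?nnegrE.
Qed.

(** Every finite set of indices lies in a square, and the sums over squares are bounded
    independently of their size. *)
Lemma summable_lim_coef :
  summable [set: nat * nat] (fun k => (lim_coef k.1 k.2 * u ^+ k.1 * v ^+ k.2)%:E).
Proof.
rewrite /summable; apply: (@le_lt_trans _ _ (2 * M + norm2 r (P 0))%:E); last exact: ltry.
apply: ge_ereal_sup => _ [X [finX _] <-].
rewrite fsbig_finite //=.
pose s : seq (nat * nat) := finmap.enum_fset (fset_set X).
pose m := (\max_(k <- s) maxn k.1 k.2).+1.
have sm k : k \in s -> (k.1 < m)%N && (k.2 < m)%N.
  move=> ks; rewrite !ltnS -geq_max.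
  exact: (leq_bigmax_seq (F := fun k : nat * nat => maxn k.1 k.2) k ks).
have le_s : \sum_(k <- s) `|lim_coef k.1 k.2 * u ^+ k.1 * v ^+ k.2| <=
    2 * M + norm2 r (P 0).
  apply: le_trans (lim_coef_sum m).
  exact: (ler_sum_square (g := fun i j => `|lim_coef i j * u ^+ i * v ^+ j|)
    _ (finmap.fset_uniq _) sm).
rewrite -lee_fin -sumEFin in le_s; exact: le_s.
Qed.


(** First [n] is chosen so that the tail bound and the distance from the value of [P n] to [l] are
    at most e/2; then [m] is taken so large that this value is exactly a square sum. *)
Lemma eval_lim_coef (l : R) : (fun n => eval2 u v (P n)) @ \oo --> l ->
  (fun m : nat => \sum_(i < m) \sum_(j < m) lim_coef i j * u ^+ i * v ^+ j) @ \oo --> l.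
Proof.
move=> Pl; apply/cvgrPdist_le => e e0.
have h0 : (fun n => 2 * M * 2^-1 ^+ n) @ \oo --> (0 : R).
  have h : geometric (2 * M) (2^-1 : R) @ \oo --> (0 : R).
    by apply: cvg_geometric; rewrite ger0_norm; lra.
  exact: h.
have e2 : 0 < e / 2 by lra.
have [n [n1 n2]] : exists n, 2 * M * 2^-1 ^+ n <= e / 2 /\ `|l - eval2 u v (P n)| <= e / 2.
  have : \forall n \near \oo, 2 * M * 2^-1 ^+ n <= e / 2 /\ `|l - eval2 u v (P n)| <= e / 2.
    near=> n; split; near: n; first exact: (cvgr_le _ h0 _ e2).
    by move/cvgrPdist_le : Pl; apply.
  by move=> [n _ Hn]; exists n; exact: Hn (leqnn n).
near=> m.
have sP : (size (P n) <= m)%N by near: m; exact: nbhs_infty_ge.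
have sPi i : (size ((P n)`_i)%R <= m)%N.
  case: (ltnP i (size (P n))) => iP; last by rewrite nth_default ?size_poly0.
  apply: (@leq_trans (\max_(i < size (P n)) size ((P n)`_i)%R)).
    exact: (@leq_bigmax _ (fun k : 'I_(size (P n)) => size ((P n)`_k)%R) (Ordinal iP)).
  by near: m; exact: nbhs_infty_ge.
have -> : l - \sum_(i < m) \sum_(j < m) lim_coef i j * u ^+ i * v ^+ j =
  (l - eval2 u v (P n))
  - \sum_(i < m) \sum_(j < m) (lim_coef i j - (P n)`_i`_j) * u ^+ i * v ^+ j.
  rewrite (eval2E _ _ sP sPi) -addrA -opprD -big_split; congr (_ - _).
  apply: eq_bigr => i _; rewrite -big_split; apply: eq_bigr => j _ /=; ring.
apply: le_trans (ler_normB _ _) _; have -> : e = e / 2 + e / 2 by field.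
apply: lerD => //; apply: le_trans n1; apply: le_trans (lim_coef_tail n m).
apply: le_trans (ler_norm_sum _ _ _) _; apply: ler_sum => i _.
apply: le_trans (ler_norm_sum _ _ _) _; apply: ler_sum => j _.
by rewrite !normrM !normrX !ler_pM ?mulr_ge0 ?exprn_ge0 // lerXn2r ?nnegrE.
Unshelve. all: by end_near.
Qed.

End Limit.
End BivariateLimit.

(** * The period equations in trigonometric form *)

Section Trigonometry.
Variable R : realType.
Implicit Types t : R.

(** The triple angle formula at t = pi/3 reads (cos t + 1)(2 cos t - 1)^2 = 0, and cos t > 0. *)
Lemma cos_pi3 : cos (pi / 3) = 1 / 2 :> R.
Proof.
set t : R := pi / 3; have tpi : t + t + t = pi by rewrite /t; field.
have pi0 : 0 < pi :> R := pi_gt0 R.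
have c0 : 0 < cos t by apply: cos_gt0_pihalf; rewrite /t; lra.
have := cospi R; rewrite -tpi !cosD !sinD => e.
have cs := cos2Dsin2 t.
have e2 : (cos t + 1) * (2 * cos t - 1) ^+ 2 = 0.
  have s2 : sin t ^+ 2 = 1 - cos t ^+ 2 by rewrite -cs; ring.
  transitivity (cos t * cos t * cos t - 3 * cos t * sin t ^+ 2 + 1); last first.
    by rewrite -[RHS](subrr (-1)) -{1}e; ring.
  by rewrite s2; ring.
have : 2 * cos t - 1 = 0.
  by apply/eqP; move/eqP : e2; rewrite mulf_eq0 sqrf_eq0 => /orP[/eqP|//]; lra.
lra.
Qed.

Lemma sin_third_gt0 (q : R) : `|q| <= brad R -> 0 < sin (2 * pi / 3 + q).
Proof.
rewrite ler_norml /brad => /andP[q1 q2]; apply: sin_gt0_pi.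
have := pi_ge2 R; lra.
Qed.

Lemma expiD t t' : expi (t + t') = expi t * expi t'.
Proof.
rewrite /expi cosD sinD; apply/eqP.
by rewrite eq_complex /= [X in _ && (X == _)]addrC !eqxx.
Qed.

Lemma expi0 : expi 0 = 1 :> R[i].
Proof. by rewrite /expi cos0 sin0. Qed.

Lemma expi_pi : expi pi = -1 :> R[i].
Proof. by rewrite /expi cospi sinpi; apply/eqP; rewrite eq_complex /= oppr0 !eqxx. Qed.

Lemma expi_neq0 t : expi t != 0.
Proof.
apply/eqP => e0; have := expi0; rewrite -(subrr t) expiD e0 mul0r => /eqP.
by rewrite eq_sym oner_eq0.
Qed.

Lemma expiN t : expi (- t) = (expi t)^-1.
Proof.
apply: (mulfI (expi_neq0 t)).
by rewrite -expiD subrr expi0 divff // expi_neq0.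
Qed.

Lemma conj_expi t : (expi t)^* = (expi t)^-1.
Proof. by rewrite -expiN /expi cosN sinN. Qed.

Lemma Num_conj_expi t : Num.conj (expi t) = (expi t)^-1.
Proof. exact: conj_expi. Qed.

Lemma Num_conj_real (r : R) : Num.conj r%:C = r%:C.
Proof. exact: conjc_real. Qed.

Lemma norm_expi t : `|expi t| = 1.
Proof. by rewrite /expi normc_def /= cos2Dsin2 sqrtr1. Qed.

Lemma expi_add_inv t : expi t + (expi t)^-1 = (2 * cos t)%:C.
Proof.
rewrite -expiN /expi cosN sinN; apply/eqP; rewrite eq_complex /=.
by rewrite subrr eqxx andbT; apply/eqP; ring.
Qed.

Lemma Im_real_expi (k t : R) : complex.Im (k%:C * expi t) = k * sin t.
Proof. by rewrite /= mul0r addr0. Qed.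

End Trigonometry.

Section PeriodEquations.
Variable R : realType.

Lemma coef_cubic_prod (K : comNzRingType) (b1 b2 b3 c1 c2 c3 : K) :
  let p := ('X^2 + b1%:P * 'X + c1%:P) * (('X^2 + b2%:P * 'X + c2%:P)
           * ('X^2 + b3%:P * 'X + c3%:P)) in
  [/\ p`_2 = c1 * c2 + c1 * c3 + c2 * c3 + b1 * b2 * c3 + b1 * b3 * c2 + b2 * b3 * c1,
      p`_3 = b1 * b2 * b3 + b1 * (c2 + c3) + b2 * (c1 + c3) + b3 * (c1 + c2)
    & p`_4 = c1 + c2 + c3 + b1 * b2 + b1 * b3 + b2 * b3].
Proof.
move=> p.
have -> : p = 'X^6 + (b1 + b2 + b3)%:P * 'X^5
   + (c1 + c2 + c3 + b1 * b2 + b1 * b3 + b2 * b3)%:P * 'X^4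
   + (b1 * b2 * b3 + b1 * (c2 + c3) + b2 * (c1 + c3) + b3 * (c1 + c2))%:P * 'X^3
   + (c1 * c2 + c1 * c3 + c2 * c3 + b1 * b2 * c3 + b1 * b3 * c2 + b2 * b3 * c1)%:P * 'X^2
   + (c1 * c2 * b3 + c1 * b2 * c3 + b1 * c2 * c3)%:P * 'X^1 + (c1 * c2 * c3)%:P.
  by rewrite /p !(polyCD, polyCM); ring.
by split; rewrite !coefD !coefCM !coefXn !coefC /= ?mulr0 ?mulr1 ?addr0 ?add0r.
Qed.

(* the factor (z - a)(z + 1/conj a) at a = r e^(it) *)
Lemma period_factor (r t : R) : r != 0 ->
  let a := r%:C * expi t in
  ('X - a%:P) * ('X + ((a^*)^-1)%:P) =
  'X^2 + (- ((r - r^-1)%:C * expi t))%:P * 'X + (- expi t ^+ 2)%:P.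
Proof.
move=> r0 a.
have u0 := expi_neq0 t.
have rC0 : r%:C != 0 :> R[i] by apply/eqP => -[] /eqP; apply/negP.
have -> : (a^*)^-1 = r%:C^-1 * expi t.
  by rewrite /a rmorphM /= Num_conj_expi Num_conj_real invfM invrK.
have -> : (r - r^-1)%:C = r%:C - r%:C^-1.
  by rewrite rmorphB /= fmorphV.
have -> : (- expi t ^+ 2)%:P = (- (a * (r%:C^-1 * expi t)))%:P.
  by congr (_%:P); rewrite /a; field.
have -> : (- ((r%:C - r%:C^-1) * expi t))%:P = - a%:P + (r%:C^-1 * expi t)%:P.
  by rewrite -polyCN -polyCD; congr (_%:P); rewrite /a; ring.
move: (_ * expi t) a => W a; rewrite polyCN polyCM; ring.
Qed.

Section Equivalence.
Variables r1 r2 r3 t2 t3 : R.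
Hypotheses (r1_gt0 : 0 < r1) (r2_gt0 : 0 < r2) (r3_gt0 : 0 < r3).

Let s1 := r1 - r1^-1.
Let s2 := r2 - r2^-1.
Let s3 := r3 - r3^-1.
Let u := expi t2.
Let v := expi t3.
Let A := period_poly r1%:C (r2%:C * expi t2) (r3%:C * expi t3).

Let K := 2 * (s1 * cos (t2 - t3) + s2 * cos t3 + s3 * cos t2) - s1 * s2 * s3.

Let coefs : [/\ A`_2 = u ^+ 2 + v ^+ 2 + u ^+ 2 * v ^+ 2
     - (s1%:C * s2%:C * u * v ^+ 2 + s1%:C * s3%:C * v * u ^+ 2 + s2%:C * s3%:C * u * v),
   A`_3 = u * v * K%:C
 & A`_4 = - (1 + u ^+ 2 + v ^+ 2)
     + s1%:C * s2%:C * u + s1%:C * s3%:C * v + s2%:C * s3%:C * u * v].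
Proof.
have -> : A = ('X^2 + (- s1%:C)%:P * 'X + (- 1)%:P)
    * (('X^2 + (- (s2%:C * u))%:P * 'X + (- u ^+ 2)%:P)
    * ('X^2 + (- (s3%:C * v))%:P * 'X + (- v ^+ 2)%:P)).
  rewrite /A /period_poly !big_cons big_nil mulr1.
  have := @period_factor r1 0 (lt0r_neq0 r1_gt0).
  rewrite expi0 !mulr1 expr1n => /= ->.
  by rewrite !period_factor ?lt0r_neq0.
have [-> -> ->] := 
  coef_cubic_prod (- s1%:C) (- (s2%:C * u)) (- (s3%:C * v)) (- 1) (- u ^+ 2) (- v ^+ 2).
have u0 : u != 0 := expi_neq0 t2; have v0 : v != 0 := expi_neq0 t3.
split; [ring| |ring].
(* Apart from the term s1 s2 s3, the terms of A_3 / (u v) pair off as w + 1/w with |w| = 1, which is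
   real. *)
have -> : K%:C = s1%:C * (u / v + v / u) + s2%:C * (v + v^-1)
    + s3%:C * (u + u^-1) - s1%:C * s2%:C * s3%:C.
  have -> : v / u = (u / v)^-1 by rewrite invf_div.
  have -> : u / v = expi (t2 - t3) by rewrite expiD expiN.
  rewrite !expi_add_inv /K !(rmorphB, rmorphD, rmorphM) /=; ring.
by field; rewrite u0 v0.
Qed.

(** The equations are the imaginary parts of A_4 e^(-i t2) and A_4 e^(-i(t2+t3)). If both vanish,
    the first number is a real k and the second yields k sin t3 = 0. *)
Lemma period_coef4_eq0 : sin t3 != 0 ->
  A`_4 = 0 <-> sin (t2 + t3) = s1 * (s2 * sin t3 + s3 * sin t2) /\
    sin (2 * t3 - t2) = s3 * (s1 * sin (t3 - t2) + s2 * sin t3).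
Proof.
have [_ _ A4] := coefs.
have u0 : u != 0 := expi_neq0 t2; have v0 : v != 0 := expi_neq0 t3.
have I1 : complex.Im (A`_4 * expi (- t2)) =
    s3 * (s1 * sin (t3 - t2) + s2 * sin t3) - sin (2 * t3 - t2).
  have -> : A`_4 * expi (- t2) = - (expi t2 + expi (- t2) + expi (2 * t3 - t2))
     + s1%:C * s2%:C + s1%:C * s3%:C * expi (t3 - t2) + s2%:C * s3%:C * expi t3.
    have -> : 2 * t3 = t3 + t3 by ring.
    by rewrite A4 !expiD !expiN -/u -/v; field.
  by rewrite /= sinN; ring.
have I2 : complex.Im (A`_4 * expi (- (t2 + t3))) =
    sin (t2 + t3) - s1 * (s2 * sin t3 + s3 * sin t2).
  have -> : A`_4 * expi (- (t2 + t3)) =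
     - (expi (- (t2 + t3)) + expi (t2 - t3) + expi (t3 - t2))
     + s1%:C * s2%:C * expi (- t3) + s1%:C * s3%:C * expi (- t2) + s2%:C * s3%:C.
    have -> : - (t2 + t3) = - t2 - t3 by ring.
    by rewrite A4 !expiD !expiN -/u -/v; field; rewrite u0 v0.
  rewrite /= !sinN; have -> : t3 - t2 = - (t2 - t3) by ring.
  by rewrite sinN; ring.
move=> s0; split=> [A40|[e1 e2]].
  by move: I1 I2; rewrite A40 !mul0r /=; split; lra.
rewrite e1 subrr in I2; rewrite e2 subrr in I1.
have : A`_4 * expi (- t2) = (complex.Re (A`_4 * expi (- t2)))%:C.
  by apply/eqP; rewrite eq_complex I1 /= !eqxx.
set k := complex.Re _ => Ak.
have : k = 0.
  move: I2; have -> : - (t2 + t3) = - t2 - t3 by ring.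
  rewrite expiD mulrA Ak Im_real_expi sinN => /eqP.
  by rewrite mulf_eq0 oppr_eq0 (negbTE s0) orbF => /eqP.
move=> k0; rewrite k0 in Ak; move/eqP : Ak; rewrite mulf_eq0 (negbTE (expi_neq0 _)) orbF.
by move/eqP.
Qed.

(** From c^2 u^2 v^2 = -1 follow the first period condition and conj(c A_2) = c A_4, so the second
    condition means A_4 = 0; the third is sin(beta + t2 + t3) K = 0. *)
Lemma period_solutionE (beta : R) : expi (2 * (beta + t2 + t3)) = -1 ->
  period_solution (expi beta) r1%:C (r2%:C * expi t2) (r3%:C * expi t3) <->
  A`_4 = 0 /\ K = 0.
Proof.
move=> hb; have [A2 A3 A4] := coefs.
have u0 : u != 0 := expi_neq0 t2; have v0 : v != 0 := expi_neq0 t3.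
pose c := expi beta; have c0 : c != 0 := expi_neq0 beta.
have cuv : c ^+ 2 * u ^+ 2 * v ^+ 2 = -1.
  rewrite -hb; have -> : 2 * (beta + t2 + t3) = beta + beta + (t2 + t2) + (t3 + t3) by ring.
  by rewrite !expiD -/c -/u -/v !expr2.
have cV : c^-1 = - (c * u ^+ 2 * v ^+ 2).
  apply: (mulfI c0); rewrite divff // -[LHS]opprK -cuv; ring.
have rC0 (r : R) : 0 < r -> r%:C != 0 :> R[i].
  by move=> r0; apply/eqP => -[] /eqP; rewrite (gt_eqF r0).
have h4 : (c * A`_2)^* = c * A`_4.
  have uJ : Num.conj u = u^-1 := conj_expi t2.
  have vJ : Num.conj v = v^-1 := conj_expi t3.
  have cJ : Num.conj c = c^-1 := conj_expi beta.
  change (Num.conj (c * A`_2) = c * A`_4).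
  rewrite rmorphM /= cJ cV A2 A4.
  rewrite !(rmorphB Num.conj, rmorphD Num.conj, rmorphM Num.conj, rmorphXn Num.conj) /=.
  rewrite !Num_conj_real uJ vJ.
  by field; rewrite u0 v0.
have h3 : complex.Im (c * A`_3) = sin (beta + t2 + t3) * K.
  rewrite A3 !mulrA [c * u]mulrC -[u * c]mulrC /c /u /v -!expiD mulrC Im_real_expi.
  exact: mulrC.
(* Otherwise the real part 1 - 2 sin^2 of e^(2i(beta+t2+t3)) would be 1 instead of -1. *)
have sg : sin (beta + t2 + t3) != 0.
  apply/eqP => s0; have := hb; have -> : 2 * (beta + t2 + t3) = (beta + t2 + t3) *+ 2 by ring.
  rewrite /expi cos_mulr2n cos2sin2 s0 => -[]; lra.
split=> [[_ _ _ e1 e2]|[A40 K0]].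
  split.
    move: e1; rewrite -/A -/c h4 => /eqP; rewrite -addr_eq0 -mulr2n mulrn_eq0 /=.
    by rewrite mulf_eq0 (negbTE c0) => /eqP.
  by move/eqP : e2; rewrite -/A -/c h3 mulf_eq0 (negbTE sg) => /eqP.
split.
- exact: norm_expi.
- by rewrite !mulf_neq0 ?rC0 ?expi_neq0.
- rewrite !big_cons big_nil mulr1 !rmorphM /= !Num_conj_real !Num_conj_expi.
  rewrite -/u -/v -/c.
  have -> : c^-1 / c = - (u ^+ 2 * v ^+ 2) by rewrite {1}cV; field.
  have := rC0 _ r1_gt0; have := rC0 _ r2_gt0; have := rC0 _ r3_gt0.
  set q1 := _%:C; set q2 := _%:C; set q3 := _%:C => q10 q20 q30.
  by field; rewrite u0 v0 q10 q20 q30.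
- by rewrite -/A -/c h4 A40 mulr0 oppr0.
- by rewrite -/A -/c h3 K0 mulr0.
Qed.

Lemma solution_setE : sin t3 != 0 ->
  solution_set (r1, r2, r3, t2, t3) <->
  [/\ sin (t2 + t3) = s1 * (s2 * sin t3 + s3 * sin t2),
      sin (2 * t3 - t2) = s3 * (s1 * sin (t3 - t2) + s2 * sin t3)
    & s1 * s2 * s3 = 2 * (s1 * cos (t2 - t3) + s2 * cos t3 + s3 * cos t2)].
Proof.
move=> s0; split=> [[_ _ _ [beta [hb]]]|[e1 e2 e3]].
  move=> /(period_solutionE hb) [/(period_coef4_eq0 s0) [e1 e2] K0].
  by split=> //; apply/eqP; rewrite eq_sym -subr_eq0 -/K K0.
(* This makes beta + t2 + t3 equal to pi/2. *)
split=> //; exists (pi / 2 - t2 - t3).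
have hb : expi (2 * (pi / 2 - t2 - t3 + t2 + t3)) = -1 :> R[i].
  by rewrite -expi_pi; congr expi; field.
split=> //; apply/(period_solutionE hb); split; first exact/(period_coef4_eq0 s0).
by rewrite /K e3 subrr.
Qed.

End Equivalence.
End PeriodEquations.

(** * Trigonometric equations as fixed point equations *)

Section FixedPointSystem.
Variable R : realType.

Notation id := (idfun : {rmorphism R -> R}).

Lemma rgapE (r : R) : 0 < r -> rgap (@rgeo R) (r - 1) = r - r^-1.
Proof.
move=> r0; rewrite /rgap /rgeo; have -> : 1 + (r - 1) = r by ring.
by field; rewrite gt_eqF.
Qed.

Lemma sin_shiftE (t h : R) : sin_shift id (@sin R) (@cos R) t h = sin (t + h).
Proof. by rewrite sinD. Qed.

Lemma cos_shiftE (t h : R) : cos_shift id (@sin R) (@cos R) t h = cos (t + h).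
Proof. by rewrite cosD. Qed.

(** Cancelling a and b leaves equations for sin a = -sin(t2+t3) and sin b = -sin(2 t3 - t2);
    cancelling z leaves K = 0. *)
Lemma fixed_system (r1 r2 r3 t2 t3 : R) : 0 < r1 -> 0 < r2 -> 0 < r3 ->
  let s1 := r1 - r1^-1 in let s2 := r2 - r2^-1 in let s3 := r3 - r3^-1 in
  let x := r1 - 1 in let y := r2 - 1 in let z := r3 - 1 in
  let a := t2 + t3 - pi in let b := 2 * t3 - t2 - pi in
  [/\ z = rstep_z x y z a b, a = rstep_a x y z a b & b = rstep_b x y z a b] <->
  [/\ sin (t2 + t3) = s1 * (s2 * sin t3 + s3 * sin t2),
      sin (2 * t3 - t2) = s3 * (s1 * sin (t3 - t2) + s2 * sin t3)
    & s1 * s2 * s3 = 2 * (s1 * cos (t2 - t3) + s2 * cos t3 + s3 * cos t2)].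
Proof.
move=> r10 r20 r30 s1 s2 s3 x y z a b.
rewrite /rstep_z /rstep_a /rstep_b /step_z /step_a /step_b !sin_shiftE !cos_shiftE.
rewrite !rgapE // -/s1 -/s2 -/s3 /=.
have -> : 2 * pi / 3 + dtheta3 id a b = t3 by rewrite /dtheta3 /a /b /=; field.
have -> : pi / 3 + dtheta32 id a b = t3 - t2 by rewrite /dtheta32 /a /b /=; field.
have e2 : pi / 3 + dtheta2 id a b = t2 by rewrite /dtheta2 /a /b /=; field.
rewrite e2; have := cosD (pi / 3) (dtheta2 id a b); rewrite e2 cos_pi3.
move: (dtheta2 id a b) => p ct2.
have -> : sin a = - sin (t2 + t3) by rewrite /a -[LHS]opprK -sinDpi subrK.
have -> : sin b = - sin (2 * t3 - t2) by rewrite /b -[LHS]opprK -sinDpi subrK.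
have -> : cos (t2 - t3) = cos (t3 - t2) by rewrite -cosN opprB.
have gz : z + rgeo z = s3 := rgapE r30.
have step_zE : 1 / 2 * (z - rgeo z + s3 * (1 - cos p + 2 * (sin (pi / 3) * sin p)) +
    s1 * s2 * s3 - 2 * (s1 * cos (t3 - t2)) - 2 * (s2 * cos t3)) =
  z + 1 / 2 * (s1 * s2 * s3 - 2 * (s1 * cos (t3 - t2) + s2 * cos t3 + s3 * cos t2)).
  by rewrite ct2 -gz; field.
rewrite step_zE; split=> -[e1 e3 e4]; split; lra.
Qed.

End FixedPointSystem.

(** * Analytic dependence on the parameters *)

Section Analyticity.
Variable R : realType.

Lemma open_norm_lt (T : topologicalType) (f : T -> R) (c : R) :
  continuous f -> open [set x | `|f x| < c].
Proof.
move=> cf; have -> : [set x | `|f x| < c] = f @^-1` [set y | `|y| < c] by [].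
apply: open_comp => [x _|]; first exact: cf.
have -> : [set y : R | `|y| < c] = Num.norm @^-1` [set y | y < c] by [].
apply: open_comp => [y _|]; [exact: norm_continuous|exact: open_lt].
Qed.

Definition param_box : set (R * R) :=
  [set p | `|p.1 - 1| < prad R /\ `|p.2 - 1| < prad R].

(** The angles are constrained through a = t2+t3-pi and b = 2 t3-t2-pi, the unknowns for which
    uniqueness is proved. *)
Definition solution_box : set (R * R * R * R * R) := [set x |
  (param_box x.1.1.1 /\ `|x.1.1.2 - 1| < brad R) /\
  (`|x.1.2 + x.2 - pi| < brad R /\ `|2 * x.2 - x.1.2 - pi| < brad R)].

Lemma open_param_box : open param_box.
Proof.
have -> : param_box = [set p | `|p.1 - 1| < prad R] `&` [set p | `|p.2 - 1| < prad R] by [].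
apply: openI; apply: open_norm_lt => x; apply: cvgB; try exact: cvg_cst.
  exact: cvg_fst.
exact: cvg_snd.
Qed.

Lemma open_solution_box : open solution_box.
Proof.
have -> : solution_box = (([set x | `|x.1.1.1.1 - 1| < prad R]
    `&` [set x | `|x.1.1.1.2 - 1| < prad R])
    `&` [set x | `|x.1.1.2 - 1| < brad R])
  `&` ([set x | `|x.1.2 + x.2 - pi| < brad R]
    `&` [set x | `|2 * x.2 - x.1.2 - pi| < brad R]) by [].
have f1 (T1 T2 : topologicalType) : continuous (@fst T1 T2) by move=> x; exact: cvg_fst.
have f2 (T1 T2 : topologicalType) : continuous (@snd T1 T2) by move=> x; exact: cvg_snd.
have cst (c : R) : continuous (fun _ : R * R * R * R * R => c) by move=> x; exact: cvg_cst.
have g1 (T1 T2 T3 : topologicalType) (f : T1 -> T2 * T3) :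
    continuous f -> continuous (fun x => (f x).1).
  by move=> cf x; apply: (continuous_comp (cf x)); exact: f1.
have g2 (T1 T2 T3 : topologicalType) (f : T1 -> T2 * T3) :
    continuous f -> continuous (fun x => (f x).2).
  by move=> cf x; apply: (continuous_comp (cf x)); exact: f2.
have k1 : continuous (fun x : R * R * R * R * R => x.1.1.1.1)
  by do 3 apply: (g1); exact: f1.
have k2 : continuous (fun x : R * R * R * R * R => x.1.1.1.2)
  by apply: (g2); do 2 apply: (g1); exact: f1.
have k3 : continuous (fun x : R * R * R * R * R => x.1.1.2)
  by apply: (g2); apply: (g1); exact: f1.
have k4 : continuous (fun x : R * R * R * R * R => x.1.2) by apply: (g2); exact: f1.
have k5 : continuous (fun x : R * R * R * R * R => x.2) by exact: f2.
apply: openI; [apply: openI; [apply: openI|]|apply: openI]; apply: open_norm_lt => x.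
- by apply: cvgB; [exact: k1|exact: cst].
- by apply: cvgB; [exact: k2|exact: cst].
- by apply: cvgB; [exact: k3|exact: cst].
- by apply: cvgB; [apply: cvgD; [exact: k4|exact: k5]|exact: cst].
- by apply: cvgB; [apply: cvgB; [apply: cvgMr; exact: k5|exact: k4]|exact: cst].
Qed.

Lemma norm2_var (r h : R) : 0 <= r ->
  norm2 r (iota2 R h + 'X) <= `|h| + r /\ norm2 r (iota2 R h + 'X%:P) <= `|h| + r.
Proof.
move=> r0; have n1 := ring_norm_poly (ring_norm_real R) r0.
have n2 := ring_norm2 r0.
have nX : poly_norm Num.norm r ('X : {poly R}) <= r.
  by apply: (poly_normX (ring_norm_real R)) => //; rewrite normr1.
have n1X : poly_norm Num.norm r (1 : {poly R}) <= 1.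
  by have := rn_iota n1 1; rewrite rmorph1 normr1.
split; apply: le_trans (rnD n2 _ _) _; apply: lerD; try exact: (rn_iota n2).
  exact: (poly_normX n1).
by rewrite /norm2 (poly_normC n1).
Qed.

(** The iteration is run on the polynomials h + X and k + Y; its limit coefficients form the power
    series. An affine combination of the limits covers every component of the final map. *)
Lemma real_analytic2_lim (e cz ca cb : R) :
  real_analytic2 param_box (fun p => e + cz * zlim (p.1 - 1) (p.2 - 1)
    + ca * alim (p.1 - 1) (p.2 - 1) + cb * blim (p.1 - 1) (p.2 - 1)).
Proof.
move=> [p1 p2] [/= hp1 hp2].
pose h := p1 - 1; pose k := p2 - 1.
(* The largest weight for which both shifted variables are guaranteed norm at most [prad]. *)
pose r := Num.min (prad R - `|h|) (prad R - `|k|).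
have r0 : 0 < r by rewrite lt_min !subr_gt0 hp1 hp2.
have rh : `|h| + r <= prad R by rewrite addrC -lerBrDr ge_min lexx.
have rk : `|k| + r <= prad R by rewrite addrC -lerBrDr ge_min lexx orbT.
have n2 := ring_norm2 (ltW r0).
pose X := iota2 R h + 'X; pose Y := iota2 R k + 'X%:P.
have Xs : norm2 r X <= prad R by apply: le_trans rh; have [] := norm2_var h (ltW r0).
have Ys : norm2 r Y <= prad R by apply: le_trans rk; have [] := norm2_var k (ltW r0).
pose I n := iterate (iota2 R) X Y n.
pose Q n := iota2 R e + iota2 R cz * (I n).1.1 + iota2 R ca * (I n).1.2 + iota2 R cb * (I n).2.
have Qgeo n : norm2 r (Q n.+1 - Q n) <= (`|cz| + `|ca| + `|cb|) * 2^-1 ^+ n.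
  have -> : Q n.+1 - Q n = iota2 R cz * ((I n.+1).1.1 - (I n).1.1)
    + iota2 R ca * ((I n.+1).1.2 - (I n).1.2) + iota2 R cb * ((I n.+1).2 - (I n).2).
    by rewrite /Q; ring.
  have [[_ _ dz] [_ _ da] [_ _ db]] := iterate_close n2 Xs Ys n.
  rewrite !mul1r in dz da db.
  have Z c w : norm2 r w <= 2^-1 ^+ n -> norm2 r (iota2 R c * w) <= `|c| * 2^-1 ^+ n.
    move=> wn; apply: le_trans (rnM n2 _ _) _.
    by apply: ler_pM => //; [exact: (rn_ge0 n2)|exact: (rn_ge0 n2)|exact: (rn_iota n2)].
  rewrite !mulrDl; apply: le_trans (rnD n2 _ _) _; apply: lerD; last exact: Z.
  by apply: le_trans (rnD n2 _ _) _; apply: lerD; exact: Z.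
exists (lim_coef Q).
have o1 : \forall x \near (p1, p2), `|x.1 - p1| < r.
  apply: (@open_nbhs_nbhs _ _ [set x : R * R | `|x.1 - p1| < r]); split.
    apply: open_norm_lt => x; apply: cvgB; [exact: cvg_fst|exact: cvg_cst].
  by rewrite /= subrr normr0.
have o2 : \forall x \near (p1, p2), `|x.2 - p2| < r.
  apply: (@open_nbhs_nbhs _ _ [set x : R * R | `|x.2 - p2| < r]); split.
    apply: open_norm_lt => x; apply: cvgB; [exact: cvg_snd|exact: cvg_cst].
  by rewrite /= subrr normr0.
near=> x => /=.
have u_r : `|x.1 - p1| <= r by apply: ltW; near: x; exact: o1.
have v_r : `|x.2 - p2| <= r by apply: ltW; near: x; exact: o2.
split; first exact: (summable_lim_coef r0 Qgeo u_r v_r).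
apply: (eval_lim_coef r0 Qgeo u_r v_r).
set u := x.1 - p1; set v := x.2 - p2.
have Xe : eval2 u v X = x.1 - 1.
  by rewrite rmorphD eval2_iota /eval2 /= /horner_eval hornerX hornerC /h /u; ring.
have Ye : eval2 u v Y = x.2 - 1.
  by rewrite rmorphD eval2_iota /eval2 /= /horner_eval hornerC hornerX /k /v; ring.
have xs : `|x.1 - 1| <= prad R.
  rewrite -Xe; exact: le_trans (norm2_eval _ (ltW r0) u_r v_r) Xs.
have ys : `|x.2 - 1| <= prad R.
  rewrite -Ye; exact: le_trans (norm2_eval _ (ltW r0) u_r v_r) Ys.
have Qe n : eval2 u v (Q n) =
    let J := iterate (idfun : {rmorphism R -> R}) (x.1 - 1) (x.2 - 1) n in
    e + cz * J.1.1 + ca * J.1.2 + cb * J.2.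
  have ei c : eval2 u v (iota2 R c) = (idfun : {rmorphism R -> R}) c by exact: eval2_iota.
  have := rmorph_iterate ei X Y n; rewrite Xe Ye => ->.
  by rewrite /Q !(rmorphD (eval2 u v), rmorphM (eval2 u v)) !eval2_iota.
have [zl al bl] := cvg_iterate xs ys.
under eq_fun do rewrite Qe /=.
apply: cvgD; last exact: cvgMr.
apply: cvgD; last exact: cvgMr.
by apply: cvgD; [exact: cvg_cst|exact: cvgMr].
Unshelve. all: by end_near.
Qed.

End Analyticity.

(** * The Weierstrass data of $H_2$ *)

Section AtH2.
Variable R : realType.

(** All radii are 1, so P = (z^2 - 1)(z^2 - u^2)(z^2 - u^4) with u = e^(i pi/3); as u^2 is a
    primitive cube root of unity, P = z^6 - 1. *)
Lemma H2_density (z : R[i]) :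
  omega_density (expi (pi / 2)) 1%:C (1%:C * expi (pi / 3)) (1%:C * expi (2 * pi / 3)) z
  = H2_omega_density z.
Proof.
rewrite /omega_density /H2_omega_density.
have -> : expi (pi / 2 : R) = 'i%R.
  by rewrite -complexiE /expi cos_pihalf sin_pihalf.
congr (_ * _); rewrite /period_poly !big_cons big_nil mulr1.
have u3 : expi (pi / 3 : R) ^+ 3 = -1.
  by rewrite -expi_pi !exprS mulr1 -!expiD; congr expi; field.
have uv : expi (2 * pi / 3 : R) = expi (pi / 3) ^+ 2.
  by rewrite expr2 -expiD; congr expi; field.
have u1 : expi (pi / 3 : R) + 1 != 0.
  apply/eqP => /eqP; rewrite eq_complex /= cos_pi3 => /andP[/eqP]; lra.
have n1 : (1 : R) != 0 := oner_neq0 _.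
have := @period_factor R 1 0 n1; rewrite expi0 mulr1 => /= ->.
rewrite !period_factor // invr1 subrr uv.
rewrite !(hornerM, hornerD, hornerC, hornerXn, hornerX) !mul0r !oppr0 !mul0r !addr0.
move: (expi (pi / 3)) u3 u1 => u u3 u1.
(* u is a root of z^3 + 1 other than -1, hence a root of z^2 - z + 1. *)
have u2 : u ^+ 2 = u - 1.
  have : (u + 1) * (u ^+ 2 - (u - 1)) = 0.
    have -> : (u + 1) * (u ^+ 2 - (u - 1)) = u ^+ 3 + 1 by ring.
    by rewrite u3 addNr.
  by move/eqP; rewrite mulf_eq0 (negbTE u1) subr_eq0 => /eqP.
have -> : (u ^+ 2) ^+ 2 = - u.
  by transitivity (u * u ^+ 3); [ring|rewrite u3; ring].
have -> : (z ^+ 2 + - 1 ^+ 2) * ((z ^+ 2 + - u ^+ 2) * (z ^+ 2 + - - u)) =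
  (z ^+ 2 - 1) * (z ^+ 4 + z ^+ 2 * (u - u ^+ 2) - u ^+ 3) by ring.
by rewrite u3 u2; ring.
Qed.

End AtH2.

(** * The solution set near $H_2$ as an analytic graph *)

Theorem mainTheorem6 (R : realType) :
  (exists beta : R,
     expi (2 * (beta + pi / 3 + 2 * pi / 3)) = -1 /\
     forall z : R[i], z != 0 ->
       omega_density (expi beta)
         1%:C (1%:C * expi (pi / 3)) (1%:C * expi (2 * pi / 3)) z
       = H2_omega_density z) /\
  exists (U : set (R * R)) (W : set (R * R * R * R * R))
         (phi : R * R -> R * R * R),
    [/\ open U, U (1, 1) & U `<=` [set p | 0 < p.1 /\ 0 < p.2]] /\
    [/\ open W, W (1, 1, 1, pi / 3, 2 * pi / 3)
      & W `<=` [set x | let: (r1, r2, r3, t2, t3) := x in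
                        [/\ 0 < r1, 0 < r2 & 0 < r3]]] /\
    (forall p, U p -> 0 < (phi p).1.1) /\
    [/\ real_analytic2 U (fun p => (phi p).1.1),
        real_analytic2 U (fun p => (phi p).1.2)
      & real_analytic2 U (fun p => (phi p).2)] /\
    @solution_set R `&` W =
      [set x | exists2 p, U p &
         x = (p.1, p.2, (phi p).1.1, (phi p).1.2, (phi p).2)].
Proof.
split.
  (* Here c = i, and the doubled angle is 3 pi. *)
  exists (pi / 2); split; last by move=> z _; exact: H2_density.
  have -> : 2 * (pi / 2 + pi / 3 + 2 * pi / 3) = pi + pi + pi :> R by field.
  by rewrite (expiD (pi + pi) pi) (expiD pi pi) expi_pi; ring.
pose Z (p : R * R) := zlim (p.1 - 1) (p.2 - 1).
pose Aa (p : R * R) := alim (p.1 - 1) (p.2 - 1).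
pose B (p : R * R) := blim (p.1 - 1) (p.2 - 1).
(* Solves a = t2+t3-pi, b = 2 t3-t2-pi for the angles; the zero coefficients give all components the
   shape required by [real_analytic2_lim]. *)
pose phi (p : R * R) := (1 + 1 * Z p + 0 * Aa p + 0 * B p,
  pi / 3 + 0 * Z p + 2 / 3 * Aa p + - (1 / 3) * B p,
  2 * pi / 3 + 0 * Z p + 1 / 3 * Aa p + 1 / 3 * B p).
have p0 : 0 < prad R by rewrite /prad; lra.
have b0 : 0 < brad R by rewrite /brad; lra.
have pr (r : R) : `|r - 1| < prad R -> 0 < r.
  by rewrite ltr_norml /prad => /andP[]; lra.
have br (r : R) : `|r - 1| < brad R -> 0 < r.
  by rewrite ltr_norml /brad => /andP[]; lra.
have bound (p : R * R) : param_box p ->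
    [/\ `|Z p| < brad R, `|Aa p| < brad R & `|B p| < brad R].
  move=> [/ltW h1 /ltW h2]; have [hz ha hb] := lim_iterate_bound h1 h2.
  have b2 : brad R / 2 < brad R by lra.
  by split; [exact: le_lt_trans hz _|exact: le_lt_trans ha _|exact: le_lt_trans hb _].
(* t3 - 2 pi/3 is a third of the sum of the two bounded quantities, so t3 stays where the sine is
   positive. *)
have sin3 (t2 t3 : R) :
    `|t2 + t3 - pi| < brad R -> `|2 * t3 - t2 - pi| < brad R -> sin t3 != 0.
  move=> ha hb; have q : `|t3 - 2 * pi / 3| <= brad R.
    by move: ha hb; rewrite !ltr_norml ler_norml => /andP[? ?] /andP[? ?];
      apply/andP; split; lra.
  by have := sin_third_gt0 q; rewrite addrC subrK => /gt_eqF ->.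
exists (@param_box R), (@solution_box R), phi; split; [|split; [|split; [|split]]].
- split.
  + exact: open_param_box.
  + by split; rewrite /= subrr normr0.
  + by move=> p [/pr h1 /pr h2].
- split.
  + exact: open_solution_box.
  + split; first by split; [split|]; rewrite /= subrr normr0.
    have e1 : pi / 3 + 2 * pi / 3 - pi = 0 :> R by field.
    have e2 : 2 * (2 * pi / 3) - pi / 3 - pi = 0 :> R by field.
    by split; rewrite /= ?e1 ?e2 normr0.
  + by move=> [[[[r1 r2] r3] t2] t3] /= [[[/pr ? /pr ?] /br ?] _].
- move=> p /bound [hz _ _]; apply: br; rewrite /phi /=.
  by have -> : 1 + 1 * Z p + 0 * Aa p + 0 * B p - 1 = Z p by ring.
- by split; exact: real_analytic2_lim.
apply/seteqP; split=> [[[[[r1 r2] r3] t2] t3]|x].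
  (* A solution in the box is a fixed point in the ball, hence by uniqueness the limit of the
     iteration. *)
  move=> [sol [[[/= h1 h2] h3] [h4 h5]]].
  have sys := (solution_setE t2 (pr _ h1) (pr _ h2) (br _ h3) (sin3 _ _ h4 h5)).1 sol.
  have [ez ea eb] := (fixed_system t2 t3 (pr _ h1) (pr _ h2) (br _ h3)).2 sys.
  have [fz fa fb] := lim_iterate_fixed (ltW h1) (ltW h2).
  have pU : param_box (r1, r2) by [].
  have [/ltW bz /ltW ba /ltW bb] := bound _ pU.
  have [uz ua ub] := fixed_unique (ltW h1) (ltW h2) (ltW h3) (ltW h4) (ltW h5) bz ba bb
    ez ea eb fz fa fb.
  have Ze : Z (r1, r2) = r3 - 1 := esym uz.
  have Ae : Aa (r1, r2) = t2 + t3 - pi := esym ua.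
  have Be : B (r1, r2) = 2 * t3 - t2 - pi := esym ub.
  exists (r1, r2) => //; rewrite /phi /= Ze Ae Be.
  by congr (_, _, _, _, _); field.
(* Conversely, the limit is a fixed point and its strict bounds place it in the open box. *)
move=> [[r1 r2] pU ->] /=.
have [h1 h2] := pU; rewrite /= in h1 h2.
have [bz ba bb] := bound _ pU.
have [fz fa fb] := lim_iterate_fixed (ltW h1) (ltW h2).
set r3 := 1 + _ + _ + _; set t2 := _ + _ + _ + - (1 / 3) * _.
set t3 := 2 * pi / 3 + _ + _ + _.
have ez : Z (r1, r2) = r3 - 1 by rewrite /r3; ring.
have ea : Aa (r1, r2) = t2 + t3 - pi by rewrite /t2 /t3; field.
have eb : B (r1, r2) = 2 * t3 - t2 - pi by rewrite /t2 /t3; field.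
rewrite ez in bz; rewrite ea in ba; rewrite eb in bb.
split; last by split.
apply/(solution_setE t2 (pr _ h1) (pr _ h2) (br _ bz) (sin3 _ _ ba bb)).
apply/(fixed_system t2 t3 (pr _ h1) (pr _ h2) (br _ bz)).
by rewrite -ez -ea -eb; split.
Qed.
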